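(* Let $(X,\|\cdot\|_X)$ and $(E,\|\cdot\|_E)$ be finite-dimensional Banach spaces, let $(Y,\Sigma,\mu)$ be a measure space, and let $K:X\times Y\to B(E)$ satisfy: (Car1) $K(x,\cdot)$ is measurable for every $x\in X$; (Car2) $K(\cdot,y)$ is continuous for a.e. $y\in Y$; (Car3) for every $x\in X$ there exist an open neighbourhood $U_x$ of $x$ and a function $D_x\in L^1(Y)$ such that for every $z\in U_x$ and a.e. $y\in Y$ we have $\|K(z,y)\|\le D_x(y)$; (Car4) $\sup_{x\in X}\int_Y\|K(x,y)\|\,d\mu(y)<\infty$; (K1) for every $\varepsilon>0$ there exist, for each $v\in X$ with $\|v\|=1$, a number $T_v>0$ and a function $L_v\in L^1(Y,B(E))$ such that for every $t\ge T_v$ $$\int_Y\|K(tv,y)-L_v(y)\|\,d\mu(y)\le\varepsilon,$$ and moreover $\sup_{\|v\|=1}T_v<\infty$. Moreover, let $F:Y\times E\to E$ satisfy: (F1) for every $z\in E$ the function $F(\cdot,z)$ is measurable; (F2) for every $z\in E$ and $\varepsilon>0$ there exists $\delta>0$ such that for a.e. $y\in Y$ and every $w\in E$: $\|w-z\|\le\delta$ implies $\|F(y,w)-F(y,z)\|\le\varepsilon$; (F3) there exists a nondecreasing continuous function $\phi:[0,\infty)\to\mathbb{R}$ such that for a.e. $y\in Y$ and every $z\in E$ we have $\|F(y,z)\|\le\phi(\|z\|)$. Then the Hammerstein operator $\mathscr{H}:L^\infty(Y,E)\to BC(X,E)$ defined by $$(\mathscr{H}f)(x):=\int_Y K(x,y)F(y,f(y))\,d\mu(y)$$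 is compact. Moreover, if $X=Y$ (with $\Sigma$ containing the Borel sets of $X$) and there is $t_*\in(0,\infty)$ satisfying $$\left(\sup_{x\in X}\int_Y\|K(x,y)\|\,d\mu(y)\right)\phi(t_* )=t_*,$$ then the Hammerstein operator $\mathscr{H}:BC(X,E)\to BC(X,E)$, given by the same formula, has a fixed point.
   Context: $B(E)$ denotes the space of bounded linear operators on $E$ with the operator norm. $L^1(Y)$ and $L^1(Y,B(E))$ are the spaces of $\mu$-integrable scalar-valued, respectively $B(E)$-valued, functions on $Y$; $L^\infty(Y,E)$ is the space of essentially bounded measurable functions $Y\to E$ with the essential supremum norm. $BC(X,E)$ is the space of bounded continuous functions $X\to E$ with the norm $\|f\|=\sup_{x\in X}\|f(x)\|_E$. A (nonlinear) operator is called compact if it is continuous and maps bounded sets to relatively compact sets. *)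

(* Defs.v *)
From HB Require Import structures.
From mathcomp Require Import all_boot all_order all_algebra.
From mathcomp Require Import all_classical all_reals all_analysis.
From mathcomp Require Import ess_sup_inf.

Set Implicit Arguments.
Unset Strict Implicit.
Unset Printing Implicit Defensive.

Import Order.TTheory GRing.Theory Num.Theory.
Import numFieldNormedType.Exports.

Local Open Scope classical_set_scope.
Local Open Scope ring_scope.

#[short(type="finBanachType")]
HB.structure Definition FinBanach (R : realType) :=
  {V of CompleteNormedModule R V & Vector R V}.

(* Borel measurability; for a finite-dimensional (hence separable) target it
   coincides with strong measurability. *)
Definition borel_fun d (Y : measurableType d) (T : ptopologicalType)
    (f : Y -> T) : Prop :=
  measurable_fun [set: Y] (f : Y -> g_sigma_algebraType (@open T)).

Section supnorm.
Context {R : realType} {I : Type} {V : normedModType R} (A : set I).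
Implicit Types f g : I -> V.

Definition bounded_on f := has_ubound [set `|f x| | x in A].

Definition supnorm f : R := sup [set `|f x| | x in A].

Lemma le_supnorm f x : bounded_on f -> A x -> `|f x| <= supnorm f.
Proof. by move=> bf Ax; apply: ub_le_sup => //; exists x. Qed.

Lemma supnorm_le f (M : R) : 0 <= M -> (forall x, A x -> `|f x| <= M) ->
  supnorm f <= M.
Proof.
move=> M0 h; rewrite /supnorm.
have [->|/set0P A0] := eqVneq [set `|f x| | x in A] set0; first by rewrite sup0.
by apply: ge_sup => // _ [x Ax <-]; exact: h.
Qed.

Lemma supnorm_ge0 f : 0 <= supnorm f.
Proof.
have [[[_ [x Ax _]] bf]|/sup_out] := pselect (has_sup [set `|f x| | x in A]).
  exact: le_trans (le_supnorm bf Ax).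
by rewrite /supnorm => ->.
Qed.

Lemma bounded_onD f g : bounded_on f -> bounded_on g -> bounded_on (f + g).
Proof.
move=> bf bg; exists (supnorm f + supnorm g) => _ [x Ax <-].
by rewrite (le_trans (ler_normD _ _))// lerD// le_supnorm.
Qed.

Lemma bounded_onZ (a : R) f : bounded_on f -> bounded_on (a *: f).
Proof.
move=> bf; exists (`|a| * supnorm f) => _ [x Ax <-].
by rewrite normrZ ler_wpM2l// le_supnorm.
Qed.

Lemma bounded_on0 : bounded_on (0 : I -> V).
Proof. by exists 0 => _ [x Ax <-]; rewrite normr0. Qed.

Lemma supnormD f g : bounded_on f -> bounded_on g ->
  supnorm (f + g) <= supnorm f + supnorm g.
Proof.
move=> bf bg; apply: supnorm_le => [|x Ax]; first by rewrite addr_ge0 ?supnorm_ge0.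
by rewrite (le_trans (ler_normD _ _))// lerD// le_supnorm.
Qed.

Lemma supnormZ (a : R) f : bounded_on f -> supnorm (a *: f) = `|a| * supnorm f.
Proof.
move=> bf; apply/eqP; rewrite eq_le; apply/andP; split.
  apply: supnorm_le => [|x Ax]; first by rewrite mulr_ge0 ?supnorm_ge0.
  by rewrite normrZ ler_wpM2l// le_supnorm.
have [->|a0] := eqVneq a 0; first by rewrite normr0 mul0r supnorm_ge0.
rewrite -ler_pdivlMl ?normr_gt0//.
apply: supnorm_le => [|x Ax]; first by rewrite mulr_ge0 ?supnorm_ge0.
rewrite ler_pdivlMl ?normr_gt0// -normrZ.
exact: (@le_supnorm (a *: f) x (bounded_onZ a bf) Ax).
Qed.

End supnorm.

Section bounded_linear_operators.
Context {R : realType} (E : normedModType R).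

Definition blin_pred : {pred E -> E} := [pred T : E -> E |
  `[< linear T /\ exists M : R, forall x, `|T x| <= M * `|x| >] ].

Lemma blin_submod_closed : submod_closed blin_pred.
Proof.
split.
  apply/asboolP; split; first by move=> a u v /=; rewrite scaler0 addr0.
  by exists 0 => x; rewrite normr0 mul0r.
move=> a S T /asboolP[lS [MS hS]] /asboolP[lT [MT hT]]; apply/asboolP; split.
  move=> b u v; rewrite !fctE lS lT !scalerDr addrACA; congr (_ + _ + _).
  by rewrite !scalerA mulrC.
exists (`|a| * MS + MT) => x; rewrite (le_trans (ler_normD _ _))//.
by rewrite normrZ mulrDl lerD// -mulrA ler_wpM2l.
Qed.

HB.instance Definition _ := GRing.isSubmodClosed.Build R (E -> E) blin_pred
  blin_submod_closed.

Record blin := Blin { blin_fun :> E -> E; _ : blin_fun \in blin_pred }.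

HB.instance Definition _ := [isSub for blin_fun].
HB.instance Definition _ := [Choice of blin by <:].
HB.instance Definition _ := [SubChoice_isSubLmodule of blin by <:].

Definition opnorm (T : blin) : R := supnorm [set x : E | `|x| <= 1] T.

Lemma blin_linear (T : blin) : linear T.
Proof. by case: T => T /= /asboolP[]. Qed.

Lemma blin_bounded (T : blin) : bounded_on [set x : E | `|x| <= 1] T.
Proof.
case: T => T /= /asboolP[_ [M hM]]; exists `|M| => _ [x /= x1 <-].
rewrite (le_trans (hM x))// (le_trans (ler_wpM2r _ (ler_norm M)))//.
by rewrite -[leRHS]mulr1 ler_wpM2l.
Qed.

Lemma opnormD S T : opnorm (S + T) <= opnorm S + opnorm T.
Proof. exact: supnormD (blin_bounded S) (blin_bounded T). Qed.

Lemma opnormZ (a : R) T : opnorm (a *: T) = `|a| * opnorm T.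
Proof. exact: supnormZ (blin_bounded T). Qed.

Lemma opnorm_eq0 T : opnorm T = 0 -> T = 0.
Proof.
move=> T0; suff Tx0 x : T x = 0 by apply/val_inj/funext.
have lT := blin_linear T.
have TZ (a : R) u : T (a *: u) = a *: T u.
  have T00 : T 0 = 0.
    by have := lT (-1) 0 0; rewrite scaler0 addr0 scaleN1r addNr.
  by have := lT a u 0; rewrite addr0 T00 addr0.
have [->|x0] := eqVneq x 0; first by rewrite -(scale0r (0 : E)) TZ !scale0r.
have nx0 : `|x| != 0 by rewrite normr_eq0.
have h : `|T (`|x|^-1 *: x)| <= 0.
  rewrite -[leRHS]T0; apply: le_supnorm; first exact: blin_bounded.
  by rewrite /= normrZ ger0_norm ?invr_ge0// mulVf.
rewrite normr_le0 in h; rewrite -(scale1r x) -(mulfV nx0) -scalerA TZ.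
by rewrite (eqP h) scaler0.
Qed.

HB.instance Definition _ :=
  Lmodule_isNormed.Build R blin opnormD opnormZ opnorm_eq0.

End bounded_linear_operators.

Section bounded_continuous_functions.
Context {R : realType} (X : topologicalType) (E : normedModType R).

Definition bc_pred : {pred X -> E} :=
  [pred f : X -> E | `[< continuous f /\ bounded_on [set: X] f >] ].

Lemma bc_submod_closed : submod_closed bc_pred.
Proof.
split.
  by apply/asboolP; split; [move=> x; exact: cvg_cst|exact: bounded_on0].
move=> a f g /asboolP[cf bf] /asboolP[cg bg]; apply/asboolP; split.
  by move=> x; apply: cvgD; [apply: cvgZr; exact: cf|exact: cg].
by apply: bounded_onD => //; exact: bounded_onZ.
Qed.

HB.instance Definition _ := GRing.isSubmodClosed.Build R (X -> E) bc_pred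
  bc_submod_closed.

Record BC := MkBC { BC_fun :> X -> E; _ : BC_fun \in bc_pred }.

HB.instance Definition _ := [isSub for BC_fun].
HB.instance Definition _ := [Choice of BC by <:].
HB.instance Definition _ := [SubChoice_isSubLmodule of BC by <:].

Definition bcnorm (f : BC) : R := supnorm [set: X] f.

Lemma BC_continuous (f : BC) : continuous f.
Proof. by case: f => f /= /asboolP[]. Qed.

Lemma BC_bounded (f : BC) : bounded_on [set: X] f.
Proof. by case: f => f /= /asboolP[]. Qed.

Lemma bcnormD f g : bcnorm (f + g) <= bcnorm f + bcnorm g.
Proof. exact: supnormD (BC_bounded f) (BC_bounded g). Qed.

Lemma bcnormZ (a : R) f : bcnorm (a *: f) = `|a| * bcnorm f.
Proof. exact: supnormZ (BC_bounded f). Qed.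

Lemma bcnorm_eq0 f : bcnorm f = 0 -> f = 0.
Proof.
move=> f0; apply/val_inj/funext => x /=; apply/eqP.
by rewrite -normr_le0 -[leRHS]f0; exact: le_supnorm (BC_bounded f) _.
Qed.

HB.instance Definition _ :=
  Lmodule_isNormed.Build R BC bcnormD bcnormZ bcnorm_eq0.

End bounded_continuous_functions.

Section borel_fun_addition.
Context {R : realType} (E : finBanachType R).

Let pt (q : {ffun 'I_(\dim {:E}) -> rat}) : E :=
  \sum_i ratr (q i) *: (vbasis {:E})`_i.

Let pt_dense (x : E) (e : R) : 0 < e -> exists q, `|pt q - x| < e.
Proof.
move=> e0; set n := \dim {:E}; set b := vbasis {:E}.
pose S : R := \sum_(i < n) `|b`_i| + 1.
have S0 : 0 < S by rewrite ltr_wpDl// sumr_ge0.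
have hq (i : 'I_n) : exists q : rat, `|ratr q - coord b i x| < e / S.
  have [|q] := @rat_in_itvoo R (coord b i x - e / S) (coord b i x + e / S).
    by rewrite ltrBlDr -addrA ltrDl addr_gt0// divr_gt0.
  by rewrite in_itv/= => /andP[h1 h2]; exists q; rewrite ltr_distl h1 h2.
have [q qP] := choice hq.
exists [ffun i => q i]; rewrite [X in _ - X](coord_vbasis (memvf x)) -/b.
rewrite -sumrB (le_lt_trans (ler_norm_sum _ _ _))//.
apply: (@le_lt_trans _ _ (\sum_(i < n) e / S * `|b`_i|)).
  apply: ler_sum => i _; rewrite ffunE -scalerBl normrZ ler_wpM2r//.
  exact/ltW/qP.
rewrite -mulr_sumr mulrAC ltr_pdivrMr// ltr_pM2l//.
by rewrite /S ltrDl.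
Qed.

Lemma borel_funD d (Y : measurableType d) (f g : Y -> E) :
  borel_fun f -> borel_fun g -> borel_fun (f + g).
Proof.
move=> mf mg; apply: (@measurability _ _ Y (g_sigma_algebraType (@open E)) _ _ (@open E)) => //.
move=> _ [U oU <-]; rewrite setTI.
pose n := \dim {:E}.
pose I := ({ffun 'I_n -> rat} * {ffun 'I_n -> rat} * rat)%type.
pose P (j : I) := 0 < (ratr j.2 : R) /\ forall u v,
  ball (pt j.1.1) (ratr j.2) u -> ball (pt j.1.2) (ratr j.2) v -> U (u + v).
pose F (j : I) := if `[<P j>] then (f @^-1` ball (pt j.1.1) (ratr j.2)) `&`
   (g @^-1` ball (pt j.1.2) (ratr j.2)) else set0.
have -> : (f + g) @^-1` U = \bigcup_j F j.
  apply/seteqP; split => y /=; last first.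
    move=> [j _]; rewrite /F; case: ifPn => // /asboolP[_ h] [h1 h2].
    exact: h.
  move=> Uy; have /nbhs_ballP[e /= e0 eU] := open_nbhs_nbhs (conj oU Uy).
  have /(@rat_in_itvoo R)[r] : 0 < e / 2 / 2 by rewrite !divr_gt0.
  rewrite in_itv/= => /andP[r0 re].
  have [q1 h1] := pt_dense (f y) r0.
  have [q2 h2] := pt_dense (g y) r0.
  exists (q1, q2, r) => //; rewrite /F asboolT; last first.
    split => //= u v; rewrite -!ball_normE /= => hu hv; apply: eU.
    rewrite -ball_normE /= opprD addrACA.
    rewrite -(subrKA (pt q1) (f y)) -(subrKA (pt q2) (g y)) addrACA.
    rewrite (splitr e) (splitr (e / 2)).
    rewrite (le_lt_trans (ler_normD _ _))// ltrD//.
      rewrite (le_lt_trans (ler_normD _ _))// ltrD//.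
        by rewrite distrC (lt_trans h1).
      by rewrite distrC (lt_trans h2).
    rewrite (le_lt_trans (ler_normD _ _))// ltrD//; first exact: lt_trans hu _.
    exact: lt_trans hv _.
  by rewrite -!ball_normE /=.
apply: countable_bigcupT_measurable => [|j]; first exact: countableP.
rewrite /F; case: ifPn => // /asboolP[j0 _].
have mpre (h : Y -> E) z t : 0 < t -> borel_fun h -> measurable (h @^-1` ball z t).
  move=> t0 mh; rewrite -[X in measurable X]setTI; apply: mh => //.
  by apply: sub_sigma_algebra; exact: ball_open.
by apply: measurableI; exact: mpre.
Qed.

End borel_fun_addition.

Lemma borel_fun_cst d (Y : measurableType d) (T : ptopologicalType) (a : T) :
  borel_fun (cst a : Y -> T).
Proof. exact: measurable_cst. Qed.

Lemma borel_fun_comp d (Y : measurableType d) (S T : ptopologicalType)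
    (h : S -> T) (f : Y -> S) :
  continuous h -> borel_fun f -> borel_fun (h \o f).
Proof.
move=> /continuousP ch mf; apply: (@measurability _ _ Y (g_sigma_algebraType (@open T)) _ _ (@open T)) => //.
move=> _ [U oU <-]; rewrite setTI comp_preimage -[X in measurable X]setTI.
by apply: mf => //; apply: sub_sigma_algebra; exact: ch.
Qed.

Section essentially_bounded.
Context d (Y : measurableType d) (R : realType).
Variable mu : {measure set Y -> \bar R}.

Section norm.
Context {E : normedModType R}.
Implicit Types f g : Y -> E.

Definition ess_norm f : \bar R := Lnorm mu +oo%E (fun y => `|f y|%:E).

Lemma ess_norm_ge0 f : (0 <= ess_norm f)%E.
Proof. exact: Lnorm_ge0. Qed.

Lemma ess_normP f (M : R) : 0 <= M ->
  (ess_norm f <= M%:E)%E <-> \forall y \ae mu, `|f y| <= M.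
Proof.
move=> M0; rewrite /ess_norm unlock.
have [mu0|] := ltP.
  split=> [/ess_supP|] h; last apply/ess_supP; apply: filterS h => y;
    by rewrite /= normr_id lee_fin.
rewrite measure_le0 => /eqP mu0; split => // _.
by apply: (@negligibleS _ _ _ _ setT) => //; exists setT; split.
Qed.

Lemma le_ess_norm f : (ess_norm f < +oo)%E ->
  \forall y \ae mu, `|f y| <= fine (ess_norm f).
Proof.
move=> foo; apply/ess_normP; rewrite ?fine_ge0 ?ess_norm_ge0// fineK//.
by rewrite ge0_fin_numE// ess_norm_ge0.
Qed.

Lemma ess_norm_fin f (M : R) : 0 <= M ->
  (\forall y \ae mu, `|f y| <= M) ->
  (ess_norm f < +oo)%E /\ fine (ess_norm f) <= M.
Proof.
move=> M0 /(ess_normP _ M0) h; have foo := le_lt_trans h (ltry M).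
by split=> //; rewrite -lee_fin fineK// ge0_fin_numE// ess_norm_ge0.
Qed.

End norm.

Context (E : finBanachType R).

Definition linf_pred : {pred Y -> E} := [pred f : Y -> E |
  `[< borel_fun f /\ (ess_norm f < +oo)%E >] ].

Lemma linf_submod_closed : submod_closed linf_pred.
Proof.
split.
  apply/asboolP; split; first exact: borel_fun_cst.
  apply: (@ess_norm_fin _ _ 0 _ _).1 => //.
  by apply: filterE => y; rewrite normr0.
move=> a f g /asboolP[mf bf] /asboolP[mg bg]; apply/asboolP; split.
  apply: borel_funD => //.
  apply: (@borel_fun_comp _ _ _ _ ( *:%R a)) => //.
  exact: scaler_continuous.
apply: (@ess_norm_fin _ _ (`|a| * fine (ess_norm f) + fine (ess_norm g)) _ _).1.
  by rewrite addr_ge0 ?mulr_ge0 ?fine_ge0 ?ess_norm_ge0.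
move: (le_ess_norm bf) (le_ess_norm bg); apply: filterS2 => y fy gy.
by rewrite (le_trans (ler_normD _ _))// lerD// normrZ ler_wpM2l.
Qed.

HB.instance Definition _ := GRing.isSubmodClosed.Build R (Y -> E) linf_pred
  linf_submod_closed.

Record linf_fun := LinfFun { linf_val :> Y -> E; _ : linf_val \in linf_pred }.

HB.instance Definition _ := [isSub for linf_val].
HB.instance Definition _ := [Choice of linf_fun by <:].
HB.instance Definition _ := [SubChoice_isSubLmodule of linf_fun by <:].

Lemma linf_borel (f : linf_fun) : borel_fun f.
Proof. by case: f => f /= /asboolP[]. Qed.

Lemma linf_ess_norm (f : linf_fun) : (ess_norm f < +oo)%E.
Proof. by case: f => f /= /asboolP[]. Qed.

Definition linf_eq (f g : linf_fun) := `[< \forall y \ae mu, f y = g y >].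

Let linf_eq_refl : reflexive linf_eq.
Proof. by move=> f; apply/asboolP; apply: filterE. Qed.

Let linf_eq_sym : symmetric linf_eq.
Proof. by move=> f g; apply/asboolP/asboolP; apply: filterS => y ->. Qed.

Let linf_eq_trans : transitive linf_eq.
Proof.
move=> g f h /asboolP fg /asboolP gh; apply/asboolP.
by move: fg gh; apply: filterS2 => y -> ->.
Qed.

Canonical linf_equiv := EquivRel linf_eq linf_eq_refl linf_eq_sym linf_eq_trans.

Local Open Scope quotient_scope.

Definition Linfty : Type := {eq_quot linf_eq}.
HB.instance Definition _ := Choice.on Linfty.
HB.instance Definition _ := EqQuotient.on Linfty.

Definition Linfty_class (f : linf_fun) : Linfty := \pi_Linfty f.

Lemma Linfty_classP (f g : linf_fun) :
  Linfty_class f = Linfty_class g <-> \forall y \ae mu, f y = g y.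
Proof.
by split=> [/eqquotP/asboolP|fg]//; apply/eqquotP/asboolP.
Qed.

Lemma Linfty_repr (u : Linfty) : Linfty_class (repr u) = u.
Proof. exact: reprK. Qed.

Let repr_class (f : linf_fun) : \forall y \ae mu, (repr (Linfty_class f)) y = f y.
Proof. by apply/Linfty_classP; rewrite Linfty_repr. Qed.

Let add (u v : Linfty) := Linfty_class (repr u + repr v).
Let opp (u : Linfty) := Linfty_class (- repr u).
Let scale (a : R) (u : Linfty) := Linfty_class (a *: repr u).

Let addE f g : add (Linfty_class f) (Linfty_class g) = Linfty_class (f + g).
Proof.
apply/Linfty_classP; move: (repr_class f) (repr_class g).
by apply: filterS2 => y /= fy gy; rewrite !fctE fy gy.
Qed.

Let oppE f : opp (Linfty_class f) = Linfty_class (- f).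
Proof.
by apply/Linfty_classP; move: (repr_class f); apply: filterS => y /= fy;
  rewrite !fctE fy.
Qed.

Let scaleE a f : scale a (Linfty_class f) = Linfty_class (a *: f).
Proof.
by apply/Linfty_classP; move: (repr_class f); apply: filterS => y /= fy;
  rewrite !fctE fy.
Qed.

Let addA : associative add.
Proof.
move=> u v w; rewrite -(Linfty_repr u) -(Linfty_repr v) -(Linfty_repr w).
by rewrite !addE addrA.
Qed.

Let addC : commutative add.
Proof. by move=> u v; rewrite /add addrC. Qed.

Let add0 : left_id (Linfty_class 0) add.
Proof. by move=> u; rewrite -(Linfty_repr u) addE add0r. Qed.

Let addN : left_inverse (Linfty_class 0) opp add.
Proof. by move=> u; rewrite -(Linfty_repr u) oppE addE addNr. Qed.

HB.instance Definition _ := GRing.isZmodule.Build Linfty addA addC add0 addN.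

Let scaleA a b u : scale a (scale b u) = scale (a * b) u.
Proof. by rewrite -(Linfty_repr u) !scaleE scalerA. Qed.

Let scale1 : left_id 1 scale.
Proof. by move=> u; rewrite -(Linfty_repr u) scaleE scale1r. Qed.

Let scaleDr : right_distributive scale +%R.
Proof.
move=> a u v; rewrite -(Linfty_repr u) -(Linfty_repr v).
rewrite (addE _ _ : _ + _ = _) !scaleE (addE _ _ : _ + _ = _).
by rewrite scalerDr.
Qed.

Let scaleDl u : {morph scale^~ u : a b / a + b}.
Proof.
move=> a b; rewrite -(Linfty_repr u) !scaleE (addE _ _ : _ + _ = _).
by rewrite scalerDl.
Qed.

HB.instance Definition _ :=
  GRing.Zmodule_isLmodule.Build R Linfty scaleA scale1 scaleDr scaleDl.

Definition linfnorm (u : Linfty) : R := fine (ess_norm (repr u)).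

Let le_linfnorm (u : Linfty) : \forall y \ae mu, `|(repr u) y| <= linfnorm u.
Proof. by apply: le_ess_norm; exact: linf_ess_norm. Qed.

Let linfnorm_ge0 (u : Linfty) : 0 <= linfnorm u.
Proof. by rewrite fine_ge0// ess_norm_ge0. Qed.

Let linfnorm_le (u : Linfty) M : 0 <= M -> (\forall y \ae mu, `|(repr u) y| <= M) ->
  linfnorm u <= M.
Proof. by move=> M0 /(ess_norm_fin M0)[]. Qed.

Let linfnormD u v : linfnorm (u + v) <= linfnorm u + linfnorm v.
Proof.
apply: linfnorm_le; first by rewrite addr_ge0.
move: (repr_class (repr u + repr v)) (le_linfnorm u) (le_linfnorm v).
apply: filterS3 => y -> hu hv.
by rewrite (le_trans (ler_normD _ _))// lerD.
Qed.

Let linfnormZ_le a u : linfnorm (a *: u) <= `|a| * linfnorm u.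
Proof.
apply: linfnorm_le; first by rewrite mulr_ge0.
move: (repr_class (a *: repr u)) (le_linfnorm u).
by apply: filterS2 => y -> hu; rewrite normrZ ler_wpM2l.
Qed.

Let linfnormZ a u : linfnorm (a *: u) = `|a| * linfnorm u.
Proof.
apply/eqP; rewrite eq_le linfnormZ_le /=.
have [->|a0] := eqVneq a 0; first by rewrite normr0 mul0r.
rewrite -ler_pdivlMl ?normr_gt0// -normfV.
by rewrite -[in leLHS](scalerK a0 u).
Qed.

Lemma linfnormE f : linfnorm (Linfty_class f) = fine (ess_norm f).
Proof.
apply/eqP; rewrite eq_le; apply/andP; split.
  apply: linfnorm_le; first by rewrite fine_ge0 ?ess_norm_ge0.
  by move: (repr_class f) (le_ess_norm (linf_ess_norm f)); apply: filterS2 => y ->.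
apply: (ess_norm_fin _ _).2; first exact: linfnorm_ge0.
by move: (repr_class f) (le_linfnorm (Linfty_class f)); apply: filterS2 => y ->.
Qed.

Let linfnorm_eq0 u : linfnorm u = 0 -> u = 0.
Proof.
move=> u0; rewrite -(Linfty_repr u); apply/Linfty_classP.
move: (le_linfnorm u); apply: filterS => y.
by rewrite u0 normr_le0 => /eqP.
Qed.

HB.instance Definition _ :=
  Lmodule_isNormed.Build R Linfty linfnormD linfnormZ linfnorm_eq0.

End essentially_bounded.

Section integration.
Context d (Y : measurableType d) (R : realType).
Variable mu : {measure set Y -> \bar R}.

(* On a measure space that is not complete, y |-> K x y (F y (f y)) need not be
   measurable; as for Bochner integrals, only a.e. equality with a measurable
   function is required. *)
Definition L1 (V : normedModType R) (f : Y -> V) : Prop :=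
  (exists2 g : Y -> V, borel_fun g & \forall y \ae mu, f y = g y) /\
  (\int[mu]_y `|f y|%:E < +oo)%E.

(* Coordinatewise; by linearity this is independent of the basis on integrable
   functions and agrees with the Bochner integral. *)
Definition vintegral (E : finBanachType R) (f : Y -> E) : E :=
  \sum_(i < \dim {:E})
     (\int[mu]_y coord (vbasis {:E}) i (f y)) *: (vbasis {:E})`_i.

Definition hammerstein (X : Type) (E : finBanachType R)
    (K : X -> Y -> blin E) (F : Y -> E -> E) (f : Y -> E) (x : X) : E :=
  vintegral (fun y => K x y (F y (f y))).

Definition kernel_bound (X : Type) (E : finBanachType R)
    (K : X -> Y -> blin E) : \bar R :=
  ereal_sup (range (fun x => \int[mu]_y `|K x y|%:E)%E).

Record kernel_conditions (X E : finBanachType R) (K : X -> Y -> blin E)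
    : Prop := {
  Car1 : forall x, borel_fun (K x) ;
  Car2 : \forall y \ae mu, continuous (K ^~ y) ;
  Car3 : forall x : X, exists (U : set X) (D : Y -> R),
    [/\ open U, U x, mu.-integrable [set: Y] (EFin \o D) &
      forall z, U z -> \forall y \ae mu, `|K z y| <= D y] ;
  Car4 : (kernel_bound K < +oo)%E ;
  K1 : forall eps : R, 0 < eps ->
    exists (T : X -> R) (L : X -> Y -> blin E),
      (forall v : X, `|v| = 1 ->
        [/\ 0 < T v, L1 (L v) &
          forall t : R, T v <= t ->
            (\int[mu]_y `|K (t *: v) y - L v y|%:E <= eps%:E)%E]) /\
      has_ubound [set T v | v in [set v : X | `|v| = 1]]
}.

Record nonlinearity_conditions (E : finBanachType R) (F : Y -> E -> E)
    (phi : R -> R) : Prop := {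
  F1 : forall z, borel_fun (F ^~ z) ;
  F2 : forall (z : E) (eps : R), 0 < eps -> exists2 delta : R, 0 < delta &
    \forall y \ae mu, forall w : E,
      `|w - z| <= delta -> `|F y w - F y z| <= eps ;
  F3_nondecreasing : {in `[0, +oo[ &, {homo phi : s t / s <= t}} ;
  F3_continuous : {within `[0, +oo[, continuous phi} ;
  F3_bound : \forall y \ae mu, forall z : E, `|F y z| <= phi `|z|
}.

End integration.

Definition compact_operator (R : realType) (U V : normedModType R)
    (T : U -> V) : Prop :=
  continuous T /\ forall B : set U, bounded_set B -> precompact (T @` B).

(* Main.v *)
(* The functions [hammerstein f], with [f] in a bounded set, satisfy
   [|h x| <= c] and [|h x - h z| <= M * osc x z], where [osc x z] is the integral
   of [|K x y - K z y|]. By dominated convergence [osc] is continuous, and by (K1)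
   every point is [osc]-close to a point of some fixed ball, so [X] is totally
   bounded for [osc]; hence a pointwise limit of such functions along an
   ultrafilter is a uniform limit, and these functions form a compact subset of
   [BC X E]. Continuity of the operator follows from (F2), which compactness of
   the balls of [E] makes uniform on bounded sets.

   The closed ball of radius [t] is mapped into itself because
   [|\int h| <= \int |h|] holds with constant 1 for an arbitrary norm on [E], by
   pairing with a norming functional. The fixed point is then given by Schauder's
   theorem, obtained from the approximate Brouwer theorem on a simplex by
   projecting on a finite net; the latter is derived from Scarf's combinatorial
   lemma, which needs neither triangulations nor homology. *)
Require Import Defs.
From mathcomp Require Import all_boot all_order all_algebra zify.

Set Implicit Arguments.
Unset Strict Implicit.
Unset Printing Implicit Defensive.

(** * Scarf's lemma and Brouwer's theorem *)

Section Dominant.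
Variables (I : finType) (P : finType) (r : I -> P -> nat).
Hypothesis r_inj : forall i, injective (r i).

(** Dominance in the sense of Scarf: no point lies strictly above the minima of [S] in all the
    orders [r i] at once. *)
Definition dominant (S : {set P}) :=
  [forall y, [exists i, [forall x in S, r i y <= r i x]]].

Lemma dominantP (S : {set P}) :
  reflect (forall y, exists i, {in S, forall x, r i y <= r i x}) (dominant S).
Proof.
apply: (iffP forallP) => h y.
  by have /existsP[i /forall_inP hi] := h y; exists i.
by have [i hi] := h y; apply/existsP; exists i; apply/forall_inP.
Qed.

Lemma exists_min (S : {set P}) p0 : p0 \in S ->
  exists m : I -> P, forall i, m i \in S /\ {in S, forall x, r i (m i) <= r i x}.
Proof.
move=> pS; exists (fun i => [arg min_(x < p0 in S) r i x]) => i.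
by case: arg_minnP => // x xS hx; split=> // y yS; exact: hx.
Qed.

(** Dominance tested on a point of [S] itself yields an order in which this point is the minimum. A
    dominant set therefore has at most [#|I|] points. *)
Lemma min_onto (S : {set P}) (m : I -> P) : dominant S ->
  (forall i, m i \in S /\ {in S, forall x, r i (m i) <= r i x}) ->
  m @: [set: I] = S.
Proof.
move=> /dominantP dS hm; apply/setP => x; apply/imsetP/idP => [[i _ ->]|xS].
  by case: (hm i).
have [i hi] := dS x; exists i => //; apply: (@r_inj i); apply/eqP.
by rewrite eqn_leq hi ?(hm i).1// (hm i).2.
Qed.

(* Two indices share their minimum over [S], and each of them gives one point
   to add: the largest one above the minima of all the other indices. *)
Lemma dominant_two_extensions (S : {set P}) p0 (slack : I -> P) :
  dominant S -> #|S|.+1 = #|I| -> p0 \in S ->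
  (forall m i k, m \in S -> {in S, forall x, r k m <= r k x} -> k != i ->
     r k m < r k (slack i)) ->
  #|[set y | (y \notin S) && dominant (y |: S)]| = 2.
Proof.
move=> dS cS p0S hslack; have [m hm] := exists_min p0S.
have mS := min_onto dS hm.
(* Pigeonhole: [m] maps [I] onto a set with one point fewer. *)
have [i1 [i2 [n12 m12]]] : exists i1 i2, i1 != i2 /\ m i1 = m i2.
  case: (boolP [exists i1, [exists i2, (i1 != i2) && (m i1 == m i2)]]).
    by move=> /existsP[i1 /existsP[i2 /andP[h /eqP e]]]; exists i1, i2.
  move=> /existsPn h; suff mi : injective m.
    by have := card_imset [set: I] mi; rewrite mS cardsT; lia.
  move=> i j mij; apply/eqP; apply: contraT => nij.
  by have /existsPn/(_ j) := h i; rewrite nij mij eqxx.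
(* [M i] collects the points above the minima of all orders except [i]; its [r i]-largest point can
   take over as the minimum of order [i]. *)
pose M i := [set y | [forall j, (j != i) ==> (r j (m j) < r j y)]].
have MP i y : reflect (forall j, j != i -> r j (m j) < r j y) (y \in M i).
  rewrite inE; apply: (iffP forallP) => h j; first by move/implyP: (h j).
  by apply/implyP/h.
have top i j : i != j -> m i = m j -> exists2 y, y \in M i &
    {in M i, forall z, r i z <= r i y}.
  move=> nij mij; have sM : slack i \in M i.
    by apply/MP => k; apply: hslack; case: (hm k).
  by exists [arg max_(y > slack i in M i) r i y]; case: arg_maxnP.
have good i j y : i != j -> m i = m j -> y \in M i ->
    {in M i, forall z, r i z <= r i y} -> (y \notin S) && dominant (y |: S).
  move=> nij mij yM ymax.
  have yS : y \notin S.
    rewrite -mS; apply/negP => /imsetP[k _ yk].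
    have [k' k'i yk'] : exists2 k', k' != i & y = m k'.
      have [ki|ki] := eqVneq k i; last by exists k.
      by exists j; [rewrite eq_sym|rewrite yk ki].
    by have /MP/(_ k' k'i) := yM; rewrite yk' ltnn.
  rewrite yS; apply/dominantP => z.
  have [k hk] := dominantP _ dS y.
  have yki : r i y <= r i (m i).
    have [<-|nki] := eqVneq k i; first exact: hk (hm k).1.
    by have /MP/(_ k nki) := yM; rewrite ltnNge hk// (hm k).1.
  have [zM|/MP zM] := boolP (z \in M i).
    exists i => x; rewrite !inE => /orP[/eqP->|xS]; first exact: ymax.
    by rewrite (leq_trans (ymax _ zM))// (leq_trans yki)// (hm i).2.
  have [l [nli hl]] : exists l, l != i /\ r l z <= r l (m l).
    case: (boolP [exists l, (l != i) && (r l z <= r l (m l))]).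
      by move=> /existsP[l /andP[]]; exists l.
    move=> /existsPn h; exfalso; apply: zM => j' j'i.
    by have := h j'; rewrite j'i/= -ltnNge.
  exists l => x; rewrite !inE => /orP[/eqP->|xS].
    by rewrite (leq_trans hl)// ltnW//; move/MP: yM; exact.
  by rewrite (leq_trans hl)// (hm l).2.
have [y1 y1M y1max] := top _ _ n12 m12.
have n21 : i2 != i1 by rewrite eq_sym.
have [y2 y2M y2max] := top _ _ n21 (esym m12).
suff -> : [set y | (y \notin S) && dominant (y |: S)] = [set y1; y2].
  rewrite cards2; suff -> : y1 != y2 by [].
  apply/eqP => y12; have [k hk] := dominantP _ dS y1.
  have [k1|nk1] := eqVneq k i1.
    move/MP: y2M => /(_ k); rewrite -y12 k1 => /(_ n12).
    by rewrite ltnNge -{1}k1 -k1 hk// (hm k).1.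
  by move/MP: y1M => /(_ k nk1); rewrite ltnNge hk// (hm k).1.
apply/setP => y; rewrite !inE; apply/idP/idP; last first.
  by move=> /orP[/eqP->|/eqP->]; [apply: (good i1 i2)|apply: (good i2 i1)].
move=> /andP[yS dy].
have y0 : y \in y |: S by rewrite !inE eqxx.
have [n hn] := exists_min y0.
have nS := min_onto dy hn.
have n_inj : injective n.
  have /imset_injP h : #|n @: [set: I]| == #|[set: I]|.
    by rewrite nS cardsU1 yS cardsT -cS.
  by move=> i j; apply: h; rewrite in_setT.
have nm k : n k != y -> n k = m k.
  have [] := hn k; rewrite !inE => /orP[/eqP->|nkS]; first by rewrite eqxx.
  move=> hk _; apply: (@r_inj k); apply/eqP; rewrite eqn_leq (hm k).2// andbT.
  by rewrite hk// inE (hm k).1 orbT.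
have concl i y' : n i = y -> y' \in M i -> {in M i, forall z, r i z <= r i y'} -> y = y'.
  move=> niy y'M y'max.
  have nj j : j != i -> n j = m j.
    by move=> nji; apply: nm; rewrite -niy; apply: contra_neq nji => /n_inj.
  have yM : y \in M i.
    apply/MP => j nji; rewrite -(nj _ nji) ltn_neqAle (hn j).2// andbT.
    apply/eqP => /r_inj; rewrite -niy => /n_inj e; by rewrite e eqxx in nji.
  apply: (@r_inj i); apply/eqP; rewrite eqn_leq y'max//=.
  have [k hk] := dominantP _ dy y'.
  have [<-|nki] := eqVneq k i; first exact: hk.
  move/MP: y'M => /(_ k nki); rewrite ltnNge hk// inE (hm k).1 orbT//.
(* [n] is injective and agrees with [m] wherever it avoids [y]; since [m i1 = m i2], the new point
   must be the minimum for [i1] or for [i2]. *)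
have [n1|/nm n1] := eqVneq (n i1) y; first by rewrite (concl i1 y1)// eqxx.
have [n2|/nm n2] := eqVneq (n i2) y; first by rewrite (concl i2 y2)// eqxx orbT.
by have := n_inj i1 i2; rewrite n1 n2 => /(_ m12) e; rewrite e eqxx in n12.
Qed.

End Dominant.

Lemma odd_sum (J : finType) (A : pred J) (F : J -> nat) :
  odd (\sum_(j | A j) F j) = odd (\sum_(j | A j && odd (F j)) 1).
Proof.
rewrite big_mkcondr/=; elim/big_rec2: _ => // j a b _ h.
by rewrite !oddD h; case: ifP.
Qed.

(** If removing [x] leaves all colors except [i0], then [c] is injective on the rest, and [c x] is
    not [i0] because [S] misses a color. So [x] shares its color with exactly one other point [x'],
    and [x], [x'] are the only points that can be removed in this way. *)
Lemma even_near_colorful (P I : finType) (c : P -> I) i0 (S : {set P}) :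
  #|S| = #|I| -> c @: S != [set: I] ->
  ~~ odd #|[set y in S | c @: (S :\ y) == [set~ i0]]|.
Proof.
move=> cS nS; set A := [set y in S | _].
have [->|[x]] := set_0Vmem A; first by rewrite cards0.
rewrite inE => /andP[xS /eqP cx].
have c_inj : {in S :\ x &, injective c}.
  apply/imset_injP; rewrite cx cardsC1 -cS.
  by rewrite (cardsD1 x S) xS.
have nx : c x != i0.
  apply: contra nS => /eqP cxi; rewrite -(setD1K xS) imsetU1 cx cxi.
  by apply/eqP/setP => k; rewrite !inE orbN.
have cSi z : z \in S -> c z != i0.
  have [->//|zx zS] := eqVneq z x.
  have : c z \in c @: (S :\ x) by apply: imset_f; rewrite !inE zx.
  by rewrite cx !inE.
have : c x \in c @: (S :\ x) by rewrite cx !inE.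
move=> /imsetP[x' x'S cxx']; move: (x'S); rewrite !inE => /andP[x'x x'S'].
suff -> : A = [set x; x'] by rewrite cards2 eq_sym x'x.
apply/setP => y; rewrite !inE; apply/idP/idP.
  move=> /andP[yS /eqP cy]; have := cSi _ yS; apply: contraLR.
  rewrite negb_or => /andP[yx yx']; rewrite negbK.
  apply: contraT => cyi; have : c y \in [set~ i0] by rewrite !inE.
  rewrite -cy => /imsetP[z]; rewrite !inE => /andP[zy zS] cyz.
  have [zx|zx] := eqVneq z x.
    have := c_inj y x'; rewrite !inE yx yS x'x x'S' cyz zx => /(_ isT isT cxx').
    by move=> yE; rewrite yE eqxx in yx'.
  have := c_inj y z; rewrite !inE yx yS zx zS => /(_ isT isT cyz) yz.
  by rewrite yz eqxx in zy.
move=> /orP[] /eqP->; first by rewrite xS cx eqxx.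
rewrite x'S'/=; apply/eqP/setP => k; rewrite !inE; apply/imsetP/idP.
  by move=> [z]; rewrite !inE => /andP[_ zS] ->; exact: cSi.
move=> ki; have : k \in [set~ i0] by rewrite !inE.
rewrite -cx => /imsetP[z]; rewrite !inE => /andP[zx zS] ->.
have [zx'|zx'] := eqVneq z x'; last by exists z; rewrite // !inE zx' zS.
by exists x; rewrite ?inE ?xS 1?eq_sym ?x'x// zx' cxx'.
Qed.

Section Scarf.
Variables (T I : finType) (rk : I -> T -> nat) (c : T -> I) (t0 : T).
Hypothesis rk_inj : forall i, injective (rk i).

(* Slack point [inr i] is lowest for [i] and above all of [T] for the other
   orders; a set [S] of [#|I|] points of [T + I] stands for the pair of
   [[set t | inl t \in S]] and the colors whose slack point is missing. *)
Let r (i : I) (p : T + I) : nat :=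
  match p with
  | inl t => (rk i t).+1
  | inr j => if j == i then 0 else (\max_t rk i t + enum_rank j).+2
  end.

Let r_inj i : injective (r i).
Proof.
have lt_max t : rk i t <= \max_t rk i t by exact: leq_bigmax.
move=> [t|j] [t'|j'] /=.
- by move=> [/rk_inj ->].
- by case: ifP => // _; have := lt_max t; lia.
- by case: ifP => // _; have := lt_max t'; lia.
- case: eqP => [->|_]; case: eqP => [->|_] // [] /addnI/val_inj.
  by move=> /enum_rank_inj ->.
Qed.

Let c' (p : T + I) := match p with inl t => c t | inr j => j end.

Let i0 := c t0.

(** Doors are one point smaller than the rooms counted in [scarf]; the color condition selects those
    relevant to the parity argument. *)
Let door (S : {set T + I}) :=
  [&& dominant r S, #|S|.+1 == #|I| & c' @: S == [set~ i0]].

Let outer : {set T + I} := [set inr i | i in [set~ i0]].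

Let outer_door : door outer.
Proof.
apply/and3P; split.
- apply/dominantP => -[t|j]; last by exists j => x _ /=; rewrite eqxx.
  exists i0 => _ /imsetP[j + ->]; rewrite !inE => /negPf ji /=; rewrite ji.
  have := leq_bigmax (F := rk i0) t; lia.
- rewrite card_imset ?cardsC1; last by move=> ? ? [].
  by rewrite prednK//; apply/card_gt0P; exists i0.
- by rewrite /outer -imset_comp (eq_imset (g := id)) ?imset_id.
Qed.

(** In order [j] the slack point of [j] has rank 0, so with [outer] present a point of [T] can be
    dominated through [i0] only. This forces the added point to be the [rk i0]-largest one. *)
Let outer_one : #|[set y | (y \notin outer) && dominant r (y |: outer)]| = 1.
Proof.
pose tm := [arg max_(t > t0) rk i0 t].
have tmax t : rk i0 t <= rk i0 tm by rewrite /tm; case: arg_maxnP => // i _; exact.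
apply/eqP/cards1P; exists (inl tm); apply/setP => y; rewrite !inE.
apply/idP/eqP => [/andP[yo /dominantP dy]|->]; last first.
  rewrite {1}/outer; apply/andP; split; first by apply/negP => /imsetP[].
  apply/dominantP => -[t|j]; last by exists j => x _ /=; rewrite eqxx.
  exists i0 => x; rewrite !inE => /orP[/eqP->//=|]; first exact: tmax.
  move=> /imsetP[j + ->]; rewrite !inE => /negPf ji /=; rewrite ji.
  have := leq_bigmax (F := rk i0) t; lia.
have slack j : j != i0 -> inr j \in y |: outer.
  by move=> ji; rewrite inE imset_f ?orbT// !inE.
have [i hi] := dy (inl tm).
have ii0 : i = i0.
  by apply/eqP; apply: contraT => /slack/hi/=; rewrite eqxx.
have /hi : y \in y |: outer by rewrite !inE eqxx.
case: y yo dy slack hi => [t|j] yo dy _ _ /=.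
  rewrite ii0 ltnS => h; congr inl; apply: (@rk_inj i0).
  by apply/eqP; rewrite eqn_leq h tmax.
have -> : j = i0 by apply/eqP; apply: contraNT yo => ji; rewrite imset_f// !inE.
by rewrite ii0 eqxx.
Qed.

(** A door made of slack points has their indices as colors and is thus [outer]. In any other door a
    point of [T] keeps the minima below the slack points, as [dominant_two_extensions] requires. *)
Let inner_two (S : {set T + I}) : door S -> S != outer ->
  #|[set y | (y \notin S) && dominant r (y |: S)]| = 2.
Proof.
move=> /and3P[dS /eqP cS /eqP cSi] nS.
have [t tS] : exists t, inl t \in S.
  apply/existsP; apply: contraT => /existsPn h; move: nS => /negP[].
  rewrite /outer -cSi -imset_comp; apply/eqP.
  rewrite -[LHS]imset_id; apply: eq_in_imset => -[t|j] //= tS.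
  by rewrite (negPf (h t)) in tS.
apply: (dominant_two_extensions r_inj (p0 := inl t) (slack := inr)) => //.
move=> m i k mS /(_ _ tS) hm ki; rewrite /= eq_sym (negPf ki).
have := leq_bigmax (F := rk k) t.
by case: m mS hm => [t'|j] _ /=; have := leq_bigmax (F := rk k) t; lia.
Qed.

(** Pairs of a door inside a room are counted in two ways. By doors the count is odd, since [outer]
    has one extension and every other door has two; by rooms it would be even if no room had all the
    colors. The points of [T] in a room with all the colors form [A]. *)
Theorem scarf : exists A : {set T}, forall y,
  exists2 i, i \in c @: A & {in A, forall x, rk i y <= rk i x}.
Proof.
suff [S dS cS] : exists2 S, dominant r S & c' @: S = [set: I].
  exists [set t | inl t \in S] => y; have [i hi] := dominantP _ _ dS (inl y).
  exists i; last by move=> x; rewrite inE => /hi.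
  have : i \in c' @: S by rewrite cS.
  move=> /imsetP[[t|j] pS ij].
    by rewrite ij; apply: imset_f; rewrite inE.
  (* The color [i] cannot come from a slack point: [inr i] has rank 0 in order [i], below
     [inl y]. *)
  by have := hi _ pS; rewrite /= ij eqxx.
pose room (S : {set T + I}) := dominant r S && (#|S| == #|I|).
case: (boolP [exists S, room S && (c' @: S == [set: I])]).
  by move=> /existsP[S /andP[/andP[dS _] /eqP cS]]; exists S.
move=> /existsPn nocol.
have : odd (\sum_(S | door S) #|[set y | (y \notin S) && dominant r (y |: S)]|).
  rewrite odd_sum (big_pred1 outer)//= => S; apply/andP/eqP => [[dS]|->].
    by apply: contraTeq => nS; rewrite inner_two.
  by rewrite outer_one.
have -> : \sum_(S | door S) #|[set y | (y \notin S) && dominant r (y |: S)]| =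
    \sum_(S | room S) #|[set y in S | c' @: (S :\ y) == [set~ i0]]|.
  under eq_bigr do rewrite -sum1_card.
  under [RHS]eq_bigr do rewrite -sum1_card.
  rewrite !pair_big_dep/=.
  (* A door with a point to add corresponds to a room with a point to remove. *)
  rewrite (reindex_onto (fun q => (q.1 :\ q.2, q.2)) (fun q => (q.2 |: q.1, q.2))).
    apply: eq_bigl => -[S y] /=; rewrite !inE /= eqxx/= -andbA.
    rewrite xpair_eqE eqxx andbT; apply/idP/idP.
      move=> /and3P[/and3P[_ cS cSi] dS /eqP SE].
      have yS : y \in S by rewrite -SE setU11.
      rewrite SE in dS; rewrite yS cSi /room dS !andbT/= -(eqP cS).
      by rewrite (cardsD1 y S) yS.
    move=> /and3P[/andP[dS cS] yS cSi].
    rewrite setD1K// eqxx dS andbT /= andbT /door cSi andbT.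
    rewrite -(eqP cS) (cardsD1 y S) yS eqxx andbT.
    apply/dominantP => z; have [i hi] := dominantP _ _ dS z; exists i => x.
    by rewrite !inE => /andP[_]; exact: hi.
  move=> [S y] /=; rewrite !inE => /andP[_ /andP[yS _]].
  by rewrite setU1K.
rewrite odd_sum big1// => S /andP[rS]; apply: contraTeq => _.
apply: even_near_colorful; first by case/andP: rS => _ /eqP.
by have := nocol S; rewrite rS.
Qed.

End Scarf.

(** Scarf's lemma is applied to the grid points of the simplex, ordered by each coordinate. The
    colors [C] of the resulting set [A] have coordinate minima that nearly exhaust the total [m], so
    the points of [A] are close to each other and small in the coordinates outside [C]. *)
Lemma grid_scarf (I : finType) (i0 : I) m (c : {ffun I -> 'I_m.+1} -> I) :
  exists t : {ffun I -> 'I_m.+1}, \sum_i t i = m /\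
  forall i, t i <= #|I| \/ exists s : {ffun I -> 'I_m.+1},
    [/\ \sum_i s i = m, c s = i &
      forall j, s j <= t j + #|I| /\ t j <= s j + #|I|].
Proof.
pose Q (t : {ffun I -> 'I_m.+1}) := \sum_i t i == m.
pose T : finType := {t | Q t}.
have t0P : \sum_j [ffun j => if j == i0 then ord_max else ord0 : 'I_m.+1] j == m.
  rewrite (bigD1 i0)//= ffunE eqxx big1 ?addn0// => j /negPf ji.
  by rewrite ffunE ji.
pose t0 : T := @exist _ (fun t => is_true (Q t)) _ t0P.
pose v (t : T) i : nat := val t i.
(* Coordinate first, with [enum_rank] breaking ties; the factor [#|T|] exceeds every rank. *)
pose rk i (t : T) := v t i * #|T| + enum_rank t.
have rk_lt i (t s : T) : v t i < v s i -> rk i t < rk i s.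
  move=> h; apply: (@leq_trans ((v t i).+1 * #|T|)).
    by rewrite /rk mulSnr ltn_add2l; exact: (ltn_ord (enum_rank t)).
  by rewrite (leq_trans _ (leq_addr _ _))// leq_mul2r h orbT.
have rk_le i (t s : T) : rk i t <= rk i s -> v t i <= v s i.
  by apply: contraLR; rewrite -!ltnNge => /rk_lt.
have rk_inj i : injective (rk i).
  move=> t s ts; have : rk i t == rk i s by rewrite ts.
  have -> : rk i t = v s i * #|T| + enum_rank t.
    by congr (_ * _ + _); apply/eqP; rewrite eqn_leq !rk_le// ts.
  by rewrite eqn_add2l => /eqP/val_inj/enum_rank_inj.
have [A hA] := scarf (c \o val) t0 rk_inj.
set C := [set (c \o val) x | x in A] in hA.
have [i1 /imsetP[t tA _] _] := hA t0.
have lower i : exists2 a, {in A, forall x : T, a <= v x i} &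
    exists2 x : T, x \in A & v x i = a.
  exists (v [arg min_(x < t in A) v x i] i).
    by case: arg_minnP => // x xA h y; exact: h.
  by exists [arg min_(x < t in A) v x i] => //; case: arg_minnP.
have {lower}[a /all_and2[a_le a_eq]] : exists a : I -> nat,
    forall i, {in A, forall x : T, a i <= v x i} /\ exists2 x : T, x \in A & v x i = a i.
  have /fin_all_exists[a ha] : forall i, exists a : nat,
    {in A, forall x : T, a <= v x i} /\ exists2 x : T, x \in A & v x i = a.
    by move=> i; have [b b1 b2] := lower i; exists b.
  by exists a.
(* Otherwise some grid point [y] would exceed the minimum [a j] for every [j] in [C], against the
   choice of [A]. The mass left over is put on [j0]. *)
have sumA : m < \sum_(i in C) (a i).+1.
  rewrite ltnNge; apply/negP => le_m.
  have [j0 j0C _] := hA t0.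
  pose y j := (if j \in C then (a j).+1 else 0) +
    (if j == j0 then m - \sum_(i in C) (a i).+1 else 0).
  have sumy : \sum_j y j = m.
    rewrite big_split/= [X in _ + X](bigD1 j0)//= eqxx.
    have <- : \sum_(i in C) (a i).+1 = \sum_i (if i \in C then (a i).+1 else 0).
      by rewrite big_mkcond.
    by rewrite [X in _ + (_ + X)]big1 ?addn0 ?subnKC// => j /negbTE->.
  have ym j : y j < m.+1 by rewrite ltnS -sumy (bigD1 j)//= leq_addr.
  have yP : \sum_j [ffun j => Ordinal (ym j)] j == m.
    by rewrite -[X in _ == X]sumy; apply/eqP/eq_bigr => j _; rewrite ffunE.
  have [j jC hj] := hA (@exist _ (fun t => is_true (Q t)) _ yP).
  have [x xA xj] := a_eq j; have /rk_le := hj _ xA.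
  by rewrite xj /v /= ffunE /= /y jC addSn ltnNge leq_addr.
have cardC : #|C| <= #|I| by rewrite max_card.
have sumx (x : T) : \sum_i v x i = m by apply/eqP; exact: (valP x).
have sumC (x : T) : \sum_(i in C) v x i <= m.
  by rewrite -(sumx x) [leqRHS](bigID [in C])/= leq_addr.
have sumS : \sum_(i in C) (a i).+1 = #|C| + \sum_(i in C) a i.
  under eq_bigr do rewrite -add1n.
  by rewrite big_split/= sum1_card.
(* The minima over [C] sum to more than [m - #|C|], which leaves less than [#|C|] for the excess of
   any coordinate. *)
have upperC (x : T) i : x \in A -> i \in C -> v x i <= a i + #|I|.
  move=> xA iC; have := sumC x; rewrite (bigD1 i)//=.
  move: sumA; rewrite sumS (bigD1 i)//=.
  have : \sum_(i0 in C | i0 != i) a i0 <= \sum_(i0 in C | i0 != i) v x i0.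
    by apply: leq_sum => k _; exact: a_le.
  move: cardC; move: (\sum_(k in C | k != i) a k) (\sum_(k in C | k != i) v x k) => s1 s2.
  move: #|C| #|I| => p q; lia.
have upperN (x : T) i : x \in A -> i \notin C -> v x i <= #|I|.
  move=> xA iC; have := sumx x; rewrite (bigID [in C])/= [X in _ + X](bigD1 i)//=.
  have : \sum_(i0 in C) a i0 <= \sum_(i0 in C) v x i0.
    by apply: leq_sum => k _; exact: a_le.
  move: sumA; rewrite sumS; move: cardC.
  move: (\sum_(k in C) a k) (\sum_(k in C) v x k) (\sum_(k | _) v x k) => s1 s2 s3.
  move: #|C| #|I| => p q; lia.
exists (val t); split=> [|i]; first exact: sumx.
have [iC|/upperN h] := boolP (i \in C); last by left; exact: h.
right; have /imsetP[s sA ->] := iC; exists (val s); split=> [|//|j]; first exact: sumx.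
have near (x y : T) : x \in A -> y \in A -> v x j <= v y j + #|I|.
  move=> xA yA; have [jC|jC] := boolP (j \in C).
    by rewrite (leq_trans (upperC _ _ xA jC))// leq_add2r a_le.
  by rewrite (leq_trans (upperN _ _ xA jC))// leq_addl.
by split; exact: near.
Qed.

From mathcomp Require Import all_classical all_reals all_analysis.
From mathcomp Require Import finmap measurable_realfun ring lra.

Import Order.TTheory GRing.Theory Num.Theory.
Import numFieldNormedType.Exports.

Local Open Scope classical_set_scope.
Local Open Scope ring_scope.

Definition simplex (R : realType) (I : finType) (x : I -> R) :=
  (forall i, 0 <= x i) /\ \sum_i x i = 1.

(** A grid point is colored by a coordinate that [g] does not decrease. At the point given by
    [grid_scarf], each coordinate is either tiny or not decreased at a nearby point, so by uniform
    continuity [g] lowers no coordinate by more than [2 * e']. *)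
Lemma brouwer_simplex (R : realType) (I : finType) (i0 : I)
    (g : (I -> R) -> I -> R) :
  (forall x, simplex x -> simplex (g x)) ->
  (forall e : R, 0 < e -> exists2 d : R, 0 < d & forall x y, simplex x -> simplex y ->
     (forall i, `|x i - y i| <= d) -> forall i, `|g x i - g y i| <= e) ->
  forall e : R, 0 < e -> exists2 x, simplex x & forall i, `|g x i - x i| <= e.
Proof.
move=> gS gU e e0.
have n0 : 0 < #|I|%:R :> R by rewrite ltr0n; apply/card_gt0P; exists i0.
pose e' := e / (2 * #|I|%:R).
have e'0 : 0 < e' by rewrite divr_gt0// mulr_gt0.
have [d d0 hd] := gU _ e'0.
pose b := Num.min d e'.
have b0 : 0 < b by rewrite lt_min d0.
(* The grid is fine enough for [#|I|] of its steps to stay within [b]. *)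
pose m := Num.truncn (#|I|%:R / b : R).
have mb : #|I|%:R / m.+1%:R <= b :> R.
  rewrite ler_pdivrMr ?ltr0n// mulrC -ler_pdivrMr// ltW//.
  exact: truncnS_gt.
pose pt (t : {ffun I -> 'I_m.+2}) (i : I) : R := (t i)%:R / m.+1%:R.
have ptS (t : {ffun I -> 'I_m.+2}) : (\sum_i t i = m.+1)%N -> simplex (pt t).
  move=> st; split=> [i|]; first by rewrite divr_ge0.
  by rewrite -mulr_suml -natr_sum st mulfV// pnatr_eq0.
have colorP x : simplex x -> exists i, x i <= g x i.
  move=> xS; apply/existsP; apply: contraT => /existsPn h.
  have [_ sx] := xS; have [_ sg] := gS _ xS.
  have : \sum_i g x i < \sum_i x i.
    apply: ltr_sum => [|i _]; last by rewrite ltNge.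
    by apply/hasP; exists i0; rewrite ?mem_index_enum.
  by rewrite sx sg ltxx.
(* By [colorP], the default [i0] is never taken on the simplex. *)
pose c t := odflt i0 [pick i | pt t i <= g (pt t) i].
have [t [st ht]] := grid_scarf i0 c.
have xS := ptS _ st; exists (pt t) => //.
have lower i : - (2 * e') <= g (pt t) i - pt t i.
  have be : b <= e' by rewrite /b ge_min lexx orbT.
  have bd : b <= d by rewrite /b ge_min lexx.
  have [ti|[s [ss cs sn]]] := ht i.
    have [g0 _] := gS _ xS; have := g0 i.
    have : pt t i <= b.
      rewrite (le_trans _ mb)// /pt ler_pM2r ?invr_gt0 ?ltr0n//.
      by rewrite ler_nat.
    lra.
  have sS := ptS _ ss.
  have cl j : `|pt s j - pt t j| <= b.
    rewrite (le_trans _ mb)// /pt -mulrBl normrM normfV normr_nat.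
    rewrite ler_pM2r ?invr_gt0 ?ltr0n// ler_distl.
    by have [h1 h2] := sn j; rewrite lerBlDr -!natrD !ler_nat h2 h1.
  have := hd _ _ sS xS (fun j => le_trans (cl j) bd) i.
  have := cl i; have : pt s i <= g (pt s) i.
    move: cs; rewrite /c; case: pickP => [k hk <-//|/= h].
    by have [k hk] := colorP _ sS; rewrite h in hk.
  rewrite !ler_norml => h1 /andP[h2 h3] /andP[h4 h5]; lra.
have e'E : 2 * e' * #|I|%:R = e by rewrite /e'; field; lra.
have n1 : 1 <= #|I|%:R :> R by rewrite ler1n; apply/card_gt0P; exists i0.
move=> i; rewrite ler_norml; apply/andP; split.
  by have := lower i; nra.
have [_ sg] := gS _ xS; have [_ sx] := xS.
(* The displacements sum to zero, so the lower bounds on all the others bound each one from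
   above. *)
have : \sum_j (g (pt t) j - pt t j) = 0 by rewrite sumrB sg sx subrr.
rewrite (bigD1 i)//= => /eqP; rewrite addr_eq0 => /eqP->.
rewrite lerNl -e'E.
apply: (@le_trans _ _ (\sum_(j | j != i) - (2 * e'))); last exact: ler_sum.
rewrite sumr_const -mulNr -[leRHS]mulr_natr ler_wnM2l//; first by lra.
by rewrite ler_nat max_card.
Qed.

(** * Schauder's theorem *)

(** The bound is asked only where the weight is nonzero, because the Schauder projection of a point
    uses just the net points near it. *)
Lemma norm_convex_comb_le (R : realType) (V : normedModType R) (I : finType)
    (x : I -> R) (p : I -> V) (c : R) :
  (forall i, 0 <= x i) -> (forall i, x i != 0 -> `|p i| <= c) ->
  `|\sum_i x i *: p i| <= (\sum_i x i) * c.
Proof.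
move=> x0 pc; rewrite (le_trans (ler_norm_sum _ _ _))// mulr_suml.
apply: ler_sum => i _; rewrite normrZ ger0_norm//.
have [->|xi] := eqVneq (x i) 0; first by rewrite !mul0r.
by rewrite ler_wpM2l// pc.
Qed.

Section Schauder.
Variables (R : realType) (V : normedModType R) (T : V -> V) (r : R) (S : set V).
Hypotheses (r0 : 0 <= r) (cS : compact S) (Sr : forall v, S v -> `|v| <= r).
Hypothesis TS : forall v, `|v| <= r -> S (T v).
Hypothesis TU : forall e : R, 0 < e -> exists2 d : R, 0 < d &
  forall u v, `|u| <= r -> `|v| <= r -> `|u - v| <= d -> `|T u - T v| <= e.

(** Schauder projection: the weights [w], supported near points of a finite net of [S], turn [T]
    into a self-map [g] of a simplex, to which the approximate Brouwer theorem applies. *)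
Let approx (e : R) : 0 < e -> exists2 x, `|x| <= r & `|T x - x| <= 2 * e.
Proof.
move=> e0; have e20 : 0 < e / 2 by rewrite divr_gt0.
have [D DS cover] : exists2 D : {fset V}, {subset D <= S} &
    forall v, S v -> exists2 p, p \in D & `|v - p| <= e / 2.
  move: cS; rewrite compact_cover => /(_ V S (fun p => ball p (e / 2))).
  move=> [p Sp|v Sv|D DS h]; first exact: ball_open.
    by exists v => //; exact: ballxx.
  exists D => // v /h[p pD]; rewrite -ball_normE/= => pv.
  by exists p; rewrite // distrC ltW.
(* The point [T 0] of [S] shows that the net, which indexes the simplex, is nonempty. *)
have [p0 p0D _] := cover _ (TS (v := 0) (eq_ind_r (fun z => z <= r) r0 (normr0 V))).
have pr (i : D) : `|val i| <= r by apply: Sr; apply/set_mem/DS; exact: valP.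
pose X (x : D -> R) := \sum_i x i *: val i.
have Xr x : simplex x -> `|X x| <= r.
  move=> [x0 x1]; rewrite -[leRHS]mul1r -x1.
  by apply: norm_convex_comb_le => // i _; exact: pr.
pose w u (i : D) := Num.max 0 (e - `|u - val i|).
have w0 u i : 0 <= w u i by rewrite le_max lexx.
pose W u := \sum_i w u i.
have We u : S u -> e / 2 <= W u.
  move=> Su; have [p pD pu] := cover u Su.
  rewrite /W (bigD1 [` pD]%fset)//= ler_wpDr ?sumr_ge0// le_max; apply/orP; right.
  by rewrite /=; lra.
have W0 u : S u -> 0 < W u by move=> Su; exact: lt_le_trans (We _ Su).
have wlip u v i : `|w u i - w v i| <= `|u - v|.
  have h1 : `|u - val i| <= `|u - v| + `|v - val i| by exact: ler_distD.
  have h2 : `|v - val i| <= `|u - v| + `|u - val i|.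
    by rewrite (distrC u v); exact: ler_distD.
  rewrite /w /Order.max; case: ltP => ?; case: ltP => ?;
    by rewrite ler_norml; apply/andP; split; lra.
pose N : R := #|{: D}|%:R.
have N0 : 0 <= N by rewrite /N.
have sumN (c : R) : \sum_(i : D) c = N * c by rewrite sumr_const mulr_natl.
(* The summand 1 keeps the denominator positive when [r] is 0. *)
have Nr0 : 0 < N * r + 1 by rewrite ltr_wpDl// mulr_ge0.
have sumNr (c : R) : 0 <= c -> \sum_(i : D) (c / (N * r + 1) * r) <= c.
  move=> c0; rewrite sumN; have -> : N * (c / (N * r + 1) * r) =
      c * (N * r) / (N * r + 1) by field; rewrite gt_eqF.
  by rewrite ler_pdivrMr// ler_wpM2l// lerDl.
have Wlip u v : `|W u - W v| <= N * `|u - v|.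
  rewrite /W -sumrB (le_trans (ler_norm_sum _ _ _))//.
  apply: (@le_trans _ _ (\sum_(i : D) `|u - v|)); first exact: ler_sum.
  by rewrite sumN.
pose g x (i : D) := w (T (X x)) i / W (T (X x)).
have gS x : simplex x -> simplex (g x).
  move=> /Xr/TS/W0 h; split=> [i|]; first by rewrite divr_ge0// ltW.
  by rewrite -mulr_suml mulfV// gt_eqF.
have gU a : 0 < a -> exists2 d, 0 < d & forall x y, simplex x -> simplex y ->
    (forall i, `|x i - y i| <= d) -> forall i, `|g x i - g y i| <= a.
  (* [b + N * b] equals [a * (e / 2)]: this bounds the numerator below, while the denominator [W u]
     is at least [e / 2]. *)
  move=> a0; pose b := a * (e / 2) / (N + 1).
  have b0 : 0 < b by rewrite divr_gt0 ?mulr_gt0// ltr_wpDl.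
  have [d d0 hd] := TU b0; exists (d / (N * r + 1)).
    by rewrite divr_gt0// ltr_wpDl// mulr_ge0.
  move=> x y xS yS xy i; set u := T (X x); set v := T (X y).
  have uv : `|u - v| <= b.
    apply: hd; [exact: Xr|exact: Xr|].
    rewrite /X -sumrB (le_trans (ler_norm_sum _ _ _))//.
    apply: (@le_trans _ _ (\sum_(i : D) (d / (N * r + 1) * r))).
      by apply: ler_sum => j _; rewrite -scalerBl normrZ ler_pM.
    exact/sumNr/ltW.
  have [Wu Wv] : e / 2 <= W u /\ e / 2 <= W v by split; apply/We/TS/Xr.
  have [Wu0 Wv0] : 0 < W u /\ 0 < W v by split; exact: lt_le_trans e20 _.
  have wv : w v i <= W v by rewrite /W (bigD1 i)//= lerDl sumr_ge0.
  rewrite /g -/u -/v.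
  have -> : w u i / W u - w v i / W v =
      ((w u i - w v i) + (w v i / W v) * (W v - W u)) / W u.
    by field; rewrite !gt_eqF.
  rewrite normrM normfV (ger0_norm (ltW Wu0)) ler_pdivrMr//.
  apply: (@le_trans _ _ (a * (e / 2))); last by rewrite ler_wpM2l// ltW.
  have -> : a * (e / 2) = b + N * b by rewrite /b; field; rewrite gt_eqF// ltr_wpDl.
  rewrite (le_trans (ler_normD _ _))// lerD//; first exact: le_trans (wlip _ _ _) uv.
  rewrite normrM ger0_norm ?divr_ge0 ?(ltW Wv0)//.
  apply: (@le_trans _ _ (1 * (N * `|v - u|))).
    by rewrite ler_pM ?divr_ge0 ?(ltW Wv0)// ler_pdivrMr// mul1r.
  by rewrite mul1r ler_wpM2l// distrC.
pose a := e / (N * r + 1).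
have a0 : 0 < a by rewrite divr_gt0.
have [x xS hx] := brouwer_simplex [` p0D]%fset gS gU a0.
exists (X x); first exact: Xr.
set u := T (X x); have Su : S u by apply/TS/Xr.
have gX : `|u - X (g x)| <= e.
  have [g0 g1] := gS _ xS.
  rewrite -[u]scale1r -g1 scaler_suml /X -sumrB.
  under eq_bigr do rewrite -scalerBr.
  rewrite -[leRHS]mul1r -g1; apply: norm_convex_comb_le => // i.
  rewrite /g -/u mulf_eq0 negb_or => /andP[+ _].
  by rewrite /w /Order.max; case: ltP => ?; [move=> _; lra|rewrite eqxx].
have Xx : `|X (g x) - X x| <= e.
  rewrite /X -sumrB (le_trans (ler_norm_sum _ _ _))//.
  apply: (@le_trans _ _ (\sum_(i : D) (a * r))).
    by apply: ler_sum => j _; rewrite -scalerBl normrZ ler_pM.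
  exact/sumNr/ltW.
rewrite mulr_natl mulr2n (le_trans (ler_distD (X (g x)) _ _))// lerD//.
Qed.

(** Without a fixed point, compactness of [S] would give a uniform positive lower bound for the
    displacement of [T], contradicting [approx]. The covering argument runs over the values
    [v = T x], since it is [S] and not the ball that is compact. *)
Lemma schauder_ball : exists v, T v = v.
Proof.
apply: contrapT => /forallNP noT.
have : \forall e \near 0^'+,
    S `<=` [set v | forall x, `|x| <= r -> T x = v -> e < `|T x - x|].
  move: cS => /compact_near_coveringP; apply => v Sv.
  have := noT v; move/eqP; rewrite -subr_eq0 -normr_gt0; set b := `|_| => b0.
  have b30 : 0 < b / 3 by rewrite divr_gt0.
  have [d d0 hd] := TU b30.
  (* If [T x] is within [m] of both [v] and [x], then [x] is within [d] of [v], so [T v] is at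
     distance less than [b] from [v], a contradiction. *)
  pose m := Num.min (d / 2) (b / 3).
  have m0 : 0 < m by rewrite lt_min b30 divr_gt0.
  have [md mb] : m <= d / 2 /\ m <= b / 3 by rewrite /m !ge_min !lexx orbT.
  exists (ball v m, [set e | e < m]) => /=.
    by split; [exact: nbhsx_ballx|exact: nbhs_right_lt].
  move=> [u e] /= [+ em] x xr Txu; rewrite -ball_normE/= -Txu => vu.
  rewrite ltNge; apply/negP => xe.
  have vx : `|v - x| <= d.
    by have := ler_distD (T x) v x; lra.
  have := hd v x (Sr Sv) xr vx; have := ler_distD (T x) (T v) v.
  by rewrite (distrC (T x) v) -/b; lra.
move=> h; have [e [/= e0 he]] : exists e : R, 0 < e /\
    (S `<=` [set v | forall x, `|x| <= r -> T x = v -> e < `|T x - x|]).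
  near ((0 : R)^'+) => e; exists e; split; first by [].
  by near: e.
have [x xr] := approx (divr_gt0 e0 (ltr0Sn R 1)).
have := he _ (TS xr) x xr erefl; lra.
Unshelve. all: by end_near.
Qed.

End Schauder.

(** * Finite-dimensional normed spaces *)

Section sublinear.
Variables (R : realType) (V : lmodType R).

Definition sublinear (q : V -> R) := (forall x y, q (x + y) <= q x + q y) /\
  (forall (t : R) x, 0 <= t -> q (t *: x) = t * q x).

Lemma sublinear0 q : sublinear q -> q 0 = 0.
Proof. by move=> [_ /(_ 0 0 (lexx _))]; rewrite scale0r mul0r. Qed.

Lemma sublinear_oppr q x : sublinear q -> - q (- x) <= q x.
Proof.
move=> qS; have [qD _] := qS; have := qD x (- x).
by rewrite subrr (sublinear0 qS); lra.
Qed.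

(* [q x = inf_(t >= 0) p (x + t a) - t p a] *)
Lemma sublinear_odd_step p a : sublinear p -> exists q,
  [/\ sublinear q, forall x, q x <= p x & q (- a) <= - p a].
Proof.
move=> pS; have [pD pZ] := pS.
pose A (x : V) := [set p (x + t *: a) - t * p a | t in [set t : R | 0 <= t]].
have A0 x : A x !=set0 by exists (p (x + 0 *: a) - 0 * p a); exists 0 => /=.
have lbA x : lbound (A x) (- p (- x)).
  move=> _ [t /= t0 <-]; have := pD (x + t *: a) (- x).
  by rewrite addrAC subrr add0r pZ//; lra.
have hA x : has_inf (A x) by split=> //; exists (- p (- x)); exact: lbA.
have qle x (t : R) : 0 <= t -> inf (A x) <= p (x + t *: a) - t * p a.
  by move=> t0; apply: ge_inf; [case: (hA x)|exists t].
have qP x c : (forall t : R, 0 <= t -> c <= p (x + t *: a) - t * p a) -> c <= inf (A x).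
  by move=> h; apply: lb_le_inf => // _ [t t0 <-]; exact: h.
have qp x : inf (A x) <= p x.
  by have := qle x 0 (lexx _); rewrite scale0r addr0 mul0r subr0.
have qZ_le (c : R) x : 0 < c -> inf (A (c *: x)) <= c * inf (A x).
  move=> c0; rewrite mulrC -ler_pdivrMr//; apply: (qP) => t t0; rewrite ler_pdivrMr//.
  apply: (le_trans (qle _ (c * t) (mulr_ge0 (ltW c0) t0))).
  rewrite -scalerA -scalerDr pZ ?(ltW c0)//; lra.
exists (fun x => inf (A x)); split=> //; last first.
  by have := qle (- a) 1 ler01; rewrite scale1r addNr (sublinear0 pS); lra.
split=> [x y|c x].
  rewrite -lerBlDr; apply: (qP) => s s0; rewrite lerBlDl -lerBlDr.
  apply: (qP) => t t0; rewrite lerBlDr.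
  apply: (le_trans (qle _ (s + t) (addr_ge0 s0 t0))).
  rewrite scalerDl addrACA.
  by have := pD (x + s *: a) (y + t *: a); lra.
rewrite le_eqVlt => /predU1P[<-|c0].
  rewrite scale0r mul0r; apply/eqP; rewrite eq_le.
  rewrite (le_trans (qp 0)) ?(sublinear0 pS)//=.
  by apply: (qP) => t t0; rewrite add0r pZ// subrr.
apply/eqP; rewrite eq_le qZ_le//=.
have := qZ_le c^-1 (c *: x); rewrite invr_gt0 c0 => /(_ isT).
by rewrite scalerA mulVf ?gt_eqF// scale1r mulrC ler_pdivlMr// mulrC.
Qed.

(** Oddness at earlier vectors survives each step: making the functional smaller lowers [q (- a)]
    and raises [- q a]. With a basis for [s] this is a finite-dimensional Hahn-Banach theorem. *)
Lemma sublinear_odd p (s : seq V) : sublinear p -> exists q,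
  [/\ sublinear q, forall x, q x <= p x & {in s, forall a, q (- a) <= - q a}].
Proof.
move=> pS; elim: s => [|a s [q [qS qp qs]]]; first by exists p.
have [q' [q'S q'q q'a]] := sublinear_odd_step a qS.
exists q'; split=> // [x|x]; first exact: le_trans (q'q x) (qp x).
rewrite in_cons => /predU1P[->|xs].
  by rewrite (le_trans q'a)// lerN2.
by rewrite (le_trans (q'q _))// (le_trans (qs _ xs))// lerN2.
Qed.

Lemma sublinear_sum q (I : finType) (c : I -> R) (b : I -> V) : sublinear q ->
  (forall i, q (- b i) <= - q (b i)) ->
  q (\sum_i c i *: b i) <= \sum_i c i * q (b i).
Proof.
move=> qS bodd; have [qD qZ] := qS; elim/big_ind2 : _ => [|x y z t xy zt|i _].
- by rewrite (sublinear0 qS).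
- by rewrite (le_trans (qD _ _))// lerD.
have [c0|/ltW c0] := leP 0 (c i); first by rewrite qZ.
have -> : c i *: b i = (- c i) *: (- b i) by rewrite scaleNr scalerN opprK.
by rewrite qZ ?oppr_ge0// -[leRHS]mulrNN ler_wpM2l// oppr_ge0.
Qed.

End sublinear.

Section findim.
Variables (R : realType) (E : finBanachType R).
Local Notation n := (\dim {:E}).
Local Notation b := (vbasis {:E}).

(** The norm is first made odd at [v], which fixes the value there, and then at the basis vectors.
    The sublinear [q] so obtained agrees with the linear functional having the same values on the
    basis. *)
Lemma norming_functional (v : E) : exists a : 'I_n -> R,
  (forall u, \sum_i coord b i u * a i <= `|u|) /\ \sum_i coord b i v * a i = `|v|.
Proof.
have pS : sublinear (fun x : E => `|x|).
  by split=> [x y|t x t0]; [exact: ler_normD|rewrite normrZ ger0_norm].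
have [p [p_sub pn pv]] := sublinear_odd_step v pS.
have [q [q_sub qp qb]] := sublinear_odd b p_sub.
have bo i : q (- b`_i) <= - q b`_i \/ (n <= i)%N.
  have [?|ni] := leqP n i; [by right|left].
  by apply: qb; apply: mem_nth; rewrite size_tuple.
have {}bo (i : 'I_n) : q (- b`_i) <= - q b`_i.
  by case: (bo i) => //; rewrite leqNgt ltn_ord.
have up u : q u <= \sum_i coord b i u * q b`_i.
  rewrite [X in q X](coord_vbasis (memvf u)).
  exact: (sublinear_sum (fun i => coord b i u) (b := fun i : 'I_n => b`_i) q_sub bo).
have lo u : \sum_i coord b i u * q b`_i <= q u.
  apply: le_trans (sublinear_oppr u q_sub).
  rewrite lerNr (le_trans (up _))// -sumrN.
  by apply: ler_sum => i _; rewrite linearN mulNr.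
exists (fun i => q b`_i); split=> [u|].
  by rewrite (le_trans (lo u))// (le_trans (qp u)).
apply/eqP; rewrite eq_le (le_trans (lo v)) ?(le_trans (qp v))//=.
apply: le_trans (up v); apply: le_trans (sublinear_oppr v q_sub).
by rewrite lerNr (le_trans (qp _)).
Qed.

Let Phi (a : 'rV[R]_n) : E := \sum_i a 0 i *: b`_i.

Let PhiB a c : Phi (a - c) = Phi a - Phi c.
Proof. by rewrite /Phi -sumrB; apply: eq_bigr => i _; rewrite !mxE scalerBl. Qed.

Let PhiZ (k : R) a : Phi (k *: a) = k *: Phi a.
Proof. by rewrite /Phi scaler_sumr; apply: eq_bigr => i _; rewrite !mxE scalerA. Qed.

Let coordPhi a i : coord b i (Phi a) = a 0 i.
Proof. by rewrite /Phi coord_sum_free// (basis_free (vbasisP fullv)). Qed.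

Let Phi_surj u : u = Phi (\row_i coord b i u).
Proof.
by rewrite [LHS](coord_vbasis (memvf u)); apply: eq_bigr => i _; rewrite mxE.
Qed.

Let mx_coord_le (a : 'rV[R]_n) i : `|a 0 i| <= `|a|.
Proof.
rewrite [leRHS]/Num.Def.normr /= mx_normrE; apply/bigmax_geP; right.
by exists (0, i).
Qed.

Let Phi_le a : `|Phi a| <= (\sum_(i < n) `|b`_i|) * `|a|.
Proof.
rewrite /Phi (le_trans (ler_norm_sum _ _ _))// mulr_suml.
by apply: ler_sum => i _; rewrite normrZ mulrC ler_wpM2l.
Qed.

Let Phi_continuous : continuous Phi.
Proof.
move=> a; apply/(@cvgrPdist_le _ _ _ (nbhs a) (nbhs_filter a)) => e e0.
pose c := \sum_(i < n) `|b`_i| + 1.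
have c0 : 0 < c by rewrite ltr_wpDl// sumr_ge0.
have ec : 0 < e / c by rewrite divr_gt0.
near=> x; rewrite -PhiB (le_trans (Phi_le _))//.
have : `|a - x| <= e / c.
  near: x; apply/nbhs_ballP; exists (e / c) => //= y.
  by rewrite -ball_normE /= => /ltW.
rewrite ler_pdivlMr// => h; apply: le_trans h; rewrite mulrC ler_wpM2l//.
by rewrite /c lerDl.
Unshelve. all: by end_near. Qed.

(** Equivalence of norms: [Phi] is injective, so the norm of [Phi a] has a positive minimum on the
    compact unit sphere of row vectors. In dimension 0 this sphere is empty and any constant will
    do. *)
Let Phi_lower : exists2 m : R, 0 < m & forall a, m * `|a| <= `|Phi a|.
Proof.
pose A := [set a : 'rV[R]_n | `|a| = 1].
have key (m : R) : (forall a, A a -> m <= `|Phi a|) -> forall a, m * `|a| <= `|Phi a|.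
  move=> h a; have [->|a0] := eqVneq a 0; first by rewrite normr0 mulr0.
  have na : 0 < `|a| by rewrite normr_gt0.
  have := h (`|a|^-1 *: a); rewrite /A /= PhiZ !normrZ ger0_norm ?invr_ge0//.
  by rewrite mulVf ?gt_eqF// ler_pdivlMl// mulrC; apply.
have [A0|A0] := pselect (A !=set0); last first.
  by exists 1 => //; apply: key => a Aa; exfalso; apply: A0; exists a.
have cA : compact A.
  apply: bounded_closed_compact.
    by exists 1; split=> [|M M1 a /= ->]; [exact: num_real|exact: ltW].
  apply: (@preimage_closed _ _ (fun a : 'rV[R]_n => `|a|) [set 1]).
    by move=> x _; exact: norm_continuous.
  exact: closed_eq.
have cf : {within A, continuous (fun a => `|Phi a|)}.
  apply: continuous_subspaceT => a.
  by apply: continuous_comp; [exact: Phi_continuous|exact: norm_continuous].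
have [c cA' hc] := EVT_min_rV A0 cA cf.
exists `|Phi c|; last by apply: key => a Aa; apply: hc; exact/mem_set.
rewrite normr_gt0; apply/eqP => Phic.
have := set_mem cA'; rewrite /A /= => c1.
have : c = 0.
  by apply/rowP => i; rewrite mxE -coordPhi Phic linear0.
by move=> c0; move: c1; rewrite c0 normr0 => /eqP; rewrite eq_sym oner_eq0.
Qed.

Lemma coord_bounded : exists2 C : R, 0 < C & forall (u : E) i,
  `|coord b i u| <= C * `|u|.
Proof.
have [m m0 hm] := Phi_lower; exists m^-1; first by rewrite invr_gt0.
move=> u i; rewrite ler_pdivlMl// {2}(Phi_surj u) (le_trans _ (hm _))//.
rewrite ler_wpM2l ?(ltW m0)// (le_trans _ (mx_coord_le _ i))//.
by rewrite mxE.
Qed.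

Lemma coord_cont i : continuous (coord b i : E -> R).
Proof.
have [C C0 hC] := coord_bounded.
move=> a; apply/(@cvgrPdist_le _ _ _ (nbhs a) (nbhs_filter a)) => e e0.
near=> x.
rewrite -linearB (le_trans (hC _ _))// -ler_pdivlMl// mulrC.
near: x; apply/nbhs_ballP; exists (e / C) => [|y]; first exact: divr_gt0.
by rewrite -ball_normE /= => /ltW.
Unshelve. all: by end_near. Qed.

Lemma findim_ball_compact (r : R) : compact [set u : E | `|u| <= r].
Proof.
have [m m0 hm] := Phi_lower.
pose A := [set a : 'rV[R]_n | `|Phi a| <= r].
have cPhi : continuous (fun a => `|Phi a|).
  move=> a.
  by apply: continuous_comp; [exact: Phi_continuous|exact: norm_continuous].
have cA : compact A.
  apply: bounded_closed_compact.
    exists (r / m); split=> [|M M1 a /= ha]; first exact: num_real.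
    rewrite (le_trans _ (ltW M1))// ler_pdivlMr// mulrC.
    exact: le_trans (hm _) ha.
  apply: (@preimage_closed _ _ (fun a : 'rV[R]_n => `|Phi a|) [set x | x <= r]).
    by move=> x _; exact: cPhi.
  exact: closed_le.
have -> : [set u : E | `|u| <= r] = Phi @` A.
  apply/seteqP; split=> u /=; last by move=> [a Aa <-].
  by move=> ur; exists (\row_i coord b i u); rewrite ?/A/= -?Phi_surj.
apply: continuous_compact => //.
exact: continuous_subspaceT.
Qed.

Lemma findim_dense_seq : exists p : nat -> E, forall x (e : R), 0 < e ->
  exists k, `|p k - x| < e.
Proof.
pose pt (q : {ffun 'I_n -> rat}) : E := \sum_i ratr (q i) *: b`_i.
(* Codes that decode to no tuple of rationals are sent to 0. *)
exists (fun k => oapp pt 0 (choice.unpickle k)) => x e e0.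
pose S : R := \sum_(i < n) `|b`_i| + 1.
have S0 : 0 < S by rewrite ltr_wpDl// sumr_ge0.
have hq (i : 'I_n) : exists q : rat, `|ratr q - coord b i x| < e / S.
  have [|q] := @rat_in_itvoo R (coord b i x - e / S) (coord b i x + e / S).
    by rewrite ltrBlDr -addrA ltrDl addr_gt0// divr_gt0.
  by rewrite in_itv/= => /andP[h1 h2]; exists q; rewrite ltr_distl h1 h2.
have [q qP] := choice hq.
exists (choice.pickle [ffun i => q i]); rewrite choice.pickleK /= [X in _ - X](Phi_surj x) /pt.
have -> : \sum_i ratr ([ffun i => q i] i) *: b`_i = Phi (\row_i ratr (q i)).
  by apply: eq_bigr => i _; rewrite ffunE mxE.
rewrite -PhiB (le_lt_trans (Phi_le _))//.
have : `|\row_i ratr (q i) - \row_i coord b i x : 'rV[R]_n| <= e / S.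
  rewrite [leLHS]/Num.Def.normr /= mx_normrE; apply/bigmax_leP; split=> [|[i j] _].
    by rewrite divr_ge0 ?ltW.
  by rewrite !mxE ltW//.
move=> h; rewrite (le_lt_trans (ler_wpM2l _ h)) ?sumr_ge0//.
rewrite mulrA ltr_pdivrMr// mulrC ltr_pM2l//.
by rewrite /S ltrDl.
Qed.

End findim.

(** * Integration of vector-valued functions *)

Section integral_ae.
Context d (Y : measurableType d) (R : realType) (mu : {measure set Y -> \bar R}).
Local Open Scope ereal_scope.
Import HBNNSimple.

(* The library's [ae_ge0_le_integral] does not apply to the norm of
   [y |-> K x y (F y (f y))], which may fail to be measurable. *)
Lemma ge0_le_integral_ae (f g : Y -> \bar R) :
  (forall y, 0 <= f y) -> (forall y, 0 <= g y) ->
  (\forall y \ae mu, f y <= g y) -> \int[mu]_y f y <= \int[mu]_y g y.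
Proof.
move=> f0 g0 [N [mN N0 fg]]; rewrite !ge0_integralTE//.
apply: ge_ereal_sup => _ [h hf <-].
have mNC : measurable (~` N) by exact: measurableC.
(* A simple function below [f] is cut off to 0 on [N]: it then lies below [g] everywhere and keeps
   its integral. *)
apply: ereal_sup_ubound; exists (proj_nnsfun h mNC); last first.
  rewrite -!integralT_nnsfun; apply: ge0_ae_eq_integral => //.
  - exact/measurable_EFinP.
  - exact/measurable_EFinP.
  - by move=> y _; rewrite lee_fin.
  - by move=> y _; rewrite lee_fin.
  - exists N; split=> // y /=; apply: contra_notP => Ny _.
    by rewrite mindicE mem_set// mulr1.
move=> y /=; rewrite mindicE.
have [Ny|Ny] := boolP (y \in ~` N); last by rewrite mulr0.
rewrite mulr1 (le_trans (hf y))//.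
by move/set_mem: Ny; apply: contra_notP => /fg.
Qed.

Lemma ae_eq_integralT (f g : Y -> \bar R) :
  (\forall y \ae mu, f y = g y) -> \int[mu]_y f y = \int[mu]_y g y.
Proof.
have ge0_eq (h k : Y -> \bar R) : (forall y, 0 <= h y) -> (forall y, 0 <= k y) ->
    (\forall y \ae mu, h y = k y) -> \int[mu]_y h y = \int[mu]_y k y.
  move=> h0 k0 hk; apply/eqP; rewrite eq_le; apply/andP; split;
    by apply: ge0_le_integral_ae => //; apply: filterS hk => y ->.
move=> fg; rewrite integralE [RHS]integralE; congr (_ - _).
  by apply: ge0_eq => //; apply: filterS fg => y; rewrite !funeposE => ->.
by apply: ge0_eq => //; apply: filterS fg => y; rewrite !funenegE => ->.
Qed.

Lemma vintegral_ae (E : finBanachType R) (f g : Y -> E) :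
  (\forall y \ae mu, f y = g y) -> vintegral mu f = vintegral mu g.
Proof.
move=> fg; apply: eq_bigr => i _; congr (fine _ *: _).
by apply: ae_eq_integralT; apply: filterS fg => y ->.
Qed.

End integral_ae.

(** * Borel measurability of vector-valued and operator-valued maps *)

Section borel.
Context d (Y : measurableType d) (R : realType).

Lemma borel_fun_real (f : Y -> R) : borel_fun f <-> measurable_fun [set: Y] f.
Proof.
split=> mf.
  move=> mY; apply: (measurability _ (RGenOpens.measurableE R)) => //.
  move=> _ [_ [a [b ->] <-]]; apply: mf => //.
  by apply: sub_sigma_algebra; exact: interval_open.
apply: (@measurability _ _ Y (g_sigma_algebraType (@open R)) _ _ (@open R)) => //.
by move=> _ [U oU <-]; apply: mf => //; exact: open_measurable.
Qed.

Variable E : finBanachType R.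
Local Notation n := (\dim {:E}).
Local Notation b := (vbasis {:E}).

Lemma borel_fun_norm (V : normedModType R) (f : Y -> V) : borel_fun f ->
  measurable_fun [set: Y] (fun y => `|f y|).
Proof.
move=> mf; apply/borel_fun_real.
exact: (borel_fun_comp (@norm_continuous _ V) mf).
Qed.

Lemma borel_fun_sum (I : Type) (s : seq I) (f : I -> Y -> E) :
  (forall i, borel_fun (f i)) -> borel_fun (fun y => \sum_(i <- s) f i y).
Proof.
move=> mf; elim: s => [|i s IHs].
  under eq_fun do rewrite big_nil; exact: borel_fun_cst.
under eq_fun do rewrite big_cons; exact: borel_funD.
Qed.

Lemma borel_funB (f g : Y -> E) : borel_fun f -> borel_fun g ->
  borel_fun (fun y => f y - g y).
Proof.
move=> mf mg; apply: borel_funD => //.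
by apply: (@borel_fun_comp _ _ _ _ -%R g) => //; exact: opp_continuous.
Qed.

Lemma borel_fun_coordP (f : Y -> E) : borel_fun f <->
  forall i, measurable_fun [set: Y] (fun y => coord b i (f y)).
Proof.
split=> [mf i|mf].
  by apply/borel_fun_real; exact: (borel_fun_comp (coord_cont (E := E) (i := i)) mf).
have -> : f = fun y => \sum_i coord b i (f y) *: b`_i.
  by apply/funext => y; exact: coord_vbasis (memvf _).
apply: borel_fun_sum => i.
apply: (@borel_fun_comp _ _ R E (fun t : R => t *: b`_i) (fun y => coord b i (f y))).
  exact: scalel_continuous.
exact/borel_fun_real.
Qed.

Lemma borel_fun_cvg (h : nat -> Y -> E) (f : Y -> E) :
  (forall k, borel_fun (h k)) -> (forall y, h ^~ y @ \oo --> f y) -> borel_fun f.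
Proof.
move=> mh hf; apply/borel_fun_coordP => i.
apply: (@measurable_fun_cvg _ _ _ _ (fun k y => coord b i (h k y))) => [k|y _].
  exact: (borel_fun_coordP (h k)).1.
by apply: continuous_cvg; [exact: coord_cont|exact: hf].
Qed.

Lemma blin_sum (T : blin E) (I : Type) (s : seq I) (c : I -> R) (v : I -> E) :
  T (\sum_(i <- s) c i *: v i) = \sum_(i <- s) c i *: T (v i).
Proof.
have T0 : T 0 = 0.
  by have := blin_linear T (-1) 0 0; rewrite scaler0 addr0 scaleN1r addNr.
elim: s => [|i s IHs]; first by rewrite !big_nil.
by rewrite !big_cons blin_linear IHs.
Qed.

Lemma opnorm_le (T : blin E) (M : R) : 0 <= M ->
  (forall u, `|T u| <= M * `|u|) -> `|T| <= M.
Proof.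
move=> M0 hM; apply: supnorm_le => // u u1.
by rewrite (le_trans (hM u))// -[leRHS]mulr1 ler_wpM2l.
Qed.

Lemma le_opnorm (T : blin E) u : `|T u| <= `|T| * `|u|.
Proof.
have TZ (a : R) v : T (a *: v) = a *: T v.
  by have := blin_sum T [:: tt] (fun=> a) (fun=> v); rewrite !big_seq1.
have [->|u0] := eqVneq u 0.
  by rewrite -(scale0r (0 : E)) TZ !scale0r !normr0 mulr0.
have nu : 0 < `|u| by rewrite normr_gt0.
have : `|T (`|u|^-1 *: u)| <= `|T|.
  apply: (le_supnorm (blin_bounded T)).
  by rewrite /= normrZ ger0_norm ?invr_ge0// mulVf// gt_eqF.
by rewrite TZ normrZ ger0_norm ?invr_ge0// ler_pdivrMl// mulrC.
Qed.

(** The operator norm is a supremum over a countable dense set of vectors. Measurability is assumed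
    vector by vector because this form passes to differences of operators through [borel_funB] on
    [E]. *)
Lemma measurable_opnorm (A : Y -> blin E) : (forall u, borel_fun (fun y => A y u)) ->
  measurable_fun [set: Y] (fun y => `|A y|).
Proof.
move=> mA; have [p hp] := findim_dense_seq E.
move=> _; apply: (measurability _ (RGenOInfty.measurableE R)) => //.
move=> _ [_ [x ->] <-]; rewrite setTI.
have [x0|x0] := ltP x 0.
  rewrite (_ : _ @^-1` _ = setT)//; apply/seteqP; split=> // y _ /=.
  by rewrite in_itv/= andbT (lt_le_trans x0).
have -> : (fun y => `|A y|) @^-1` `]x, +oo[%classic =
    \bigcup_k [set y | x * `|p k| < `|A y (p k)|].
  apply/seteqP; split=> y /=; rewrite in_itv/= andbT; last first.
    move=> [k _ /= xk]; rewrite ltNge; apply/negP => Ax.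
    have := le_lt_trans (ler_wpM2r (normr_ge0 (p k)) Ax) xk.
    by rewrite ltNge le_opnorm.
  move=> xA; apply: contrapT => h; have {}h k : `|A y (p k)| <= x * `|p k|.
    by rewrite leNgt; apply/negP => xk; apply: h; exists k.
  move: xA; apply/negP; rewrite -leNgt; apply: opnorm_le => // u.
  (* Passing from [u] to [p k] costs at most the norm of [A y] on the left and [x] on the right,
     times the distance between the two vectors. *)
  apply/ler_addgt0Pr => e e0; pose c := `|A y| + x + 1.
  have c0 : 0 < c by rewrite ltr_wpDl// addr_ge0.
  have [k hk] := hp u _ (divr_gt0 e0 c0).
  have Ak : `|A y u| <= `|A y (p k)| + `|A y| * `|p k - u|.
    have -> : A y u = A y (p k) - A y (p k - u).
      (* The difference is written as a linear combination with coefficients 1 and -1. *)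
      have := blin_sum (A y) [:: 1; -1 : R] id (fun t => if t == 1 then p k else u).
      rewrite !big_cons !big_nil eqxx (_ : -1 == 1 :> R = false); last by apply/eqP; lra.
      by rewrite !addr0 !scaleN1r !scale1r => ->; rewrite opprB addrC subrK.
    by rewrite (le_trans (ler_normB _ _))// lerD// le_opnorm.
  have pk : `|p k| <= `|u| + `|p k - u|.
    by rewrite -{1}(subrK u (p k)) addrC ler_normD.
  have : `|p k - u| * c <= e by rewrite -ler_pdivlMr// ltW.
  have := h k; have := normr_ge0 (A y); have := normr_ge0 (p k - u).
  by rewrite /c; nra.
apply: bigcup_measurable => k _.
have mAk : measurable_fun [set: Y] (fun y => `|A y (p k)|) by exact: borel_fun_norm.
rewrite -[X in measurable X]setTI.
rewrite (_ : [set y | _] = (fun y => `|A y (p k)|) @^-1` `]x * `|p k|, +oo[%classic).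
  by apply: mAk.
by apply/seteqP; split=> y /=; rewrite in_itv/= andbT.
Qed.

Lemma borel_fun_eval (A : Y -> blin E) u : borel_fun A -> borel_fun (fun y => A y u).
Proof.
apply: (@borel_fun_comp _ _ (blin E) E (fun T : blin E => T u)) => T.
apply/(@cvgrPdist_le _ _ _ (nbhs T) (nbhs_filter T)) => e e0.
have ue : 0 < e / (`|u| + 1) by rewrite divr_gt0// ltr_wpDl.
near=> S.
have -> : T u - S u = (T - S) u by [].
rewrite (le_trans (le_opnorm _ _))//.
apply: (@le_trans _ _ (e / (`|u| + 1) * `|u|)).
  rewrite ler_wpM2r//; near: S; apply/nbhs_ballP; exists (e / (`|u| + 1)) => // S'.
rewrite mulrAC ler_pdivrMr ?ltr_wpDl// ler_wpM2l ?lerDl// ltW//.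
Unshelve. all: by end_near. Qed.

(** In coordinates, applying an operator to a vector is a finite sum of products of measurable real
    functions. *)
Lemma borel_fun_app (A : Y -> blin E) (f : Y -> E) :
  (forall u, borel_fun (fun y => A y u)) -> borel_fun f ->
  borel_fun (fun y => A y (f y)).
Proof.
move=> mA mf; apply/borel_fun_coordP => j.
have -> : (fun y => coord b j (A y (f y))) =
    fun y => \sum_i coord b i (f y) * coord b j (A y b`_i).
  apply/funext => y; rewrite [f y in LHS](coord_vbasis (memvf _)) blin_sum linear_sum/=.
  by apply: eq_bigr => i _; rewrite linearZ.
apply: measurable_sum => i; apply: measurable_funM.
  exact: (borel_fun_coordP f).1.
exact: (borel_fun_coordP (fun y => A y b`_i)).1.
Qed.

End borel.

Section vintegral.
Context d (Y : measurableType d) (R : realType) (mu : {measure set Y -> \bar R}).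
Variable E : finBanachType R.
Local Notation n := (\dim {:E}).
Local Notation b := (vbasis {:E}).

Lemma integrable_coord (f : Y -> E) i : borel_fun f ->
  (\int[mu]_y `|f y|%:E < +oo)%E ->
  mu.-integrable setT (fun y => (coord b i (f y))%:E).
Proof.
move=> mf foo; have [C C0 hC] := coord_bounded E.
have mc := (borel_fun_coordP f).1 mf i.
apply/integrableP; split; first exact/measurable_EFinP.
have -> : (fun y => `|(coord b i (f y))%:E|%E) = (fun y => `|coord b i (f y)|%:E).
  by apply/funext.
apply: (@le_lt_trans _ _ (\int[mu]_y (C%:E * `|f y|%:E))%E).
  apply: ge0_le_integral_ae => [y|y|]; rewrite ?lee_fin//.
    by rewrite mulr_ge0// ltW.
  by apply: filterE => y; rewrite -EFinM lee_fin.
rewrite ge0_integralZl//; last by rewrite lee_fin ltW.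
  by rewrite lte_mul_pinfty// lee_fin ltW.
by apply/measurable_EFinP; exact: borel_fun_norm.
Qed.

(* Pairing with a norming functional gives the bound for every norm on [E]. *)
Lemma norm_vintegral_le (f : Y -> E) : borel_fun f ->
  (\int[mu]_y `|f y|%:E < +oo)%E ->
  (`|vintegral mu f|%:E <= \int[mu]_y `|f y|%:E)%E.
Proof.
move=> mf foo; have ic i := integrable_coord i mf foo.
have [a [ha av]] := norming_functional (vintegral mu f).
have mn : measurable_fun setT (fun y => `|f y|%:E).
  by apply/measurable_EFinP; exact: borel_fun_norm.
have inorm : mu.-integrable setT (fun y => `|f y|%:E).
  apply/integrableP; split=> //.
  by under eq_integral do rewrite gee0_abs ?lee_fin//.
have iz i : mu.-integrable setT (fun y => (coord b i (f y) * a i)%:E).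
  have := integrableZr measurableT (a i) (ic i).
  by apply: eq_integrable => // y _; rewrite /= -EFinM.
rewrite -av.
have -> : (\sum_i coord b i (vintegral mu f) * a i)%:E =
    (\int[mu]_y \sum_(i < n) (coord b i (f y) * a i)%:E)%E.
  rewrite integral_sum// -sumEFin; apply: eq_bigr => i _.
  rewrite /vintegral coord_sum_free ?(basis_free (vbasisP fullv))//.
  under [RHS]eq_integral do rewrite EFinM muleC.
  rewrite integralZl// muleC EFinM; congr (_ * _)%E.
  by rewrite fineK//; exact: integrable_fin_num.
apply: le_integral => //; first exact: integrable_sum.
by move=> y _; rewrite sumEFin lee_fin.
Qed.

Lemma vintegralB (f g : Y -> E) : borel_fun f -> borel_fun g ->
  (\int[mu]_y `|f y|%:E < +oo)%E -> (\int[mu]_y `|g y|%:E < +oo)%E ->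
  vintegral mu f - vintegral mu g = vintegral mu (fun y => f y - g y).
Proof.
move=> mf mg foo goo; rewrite /vintegral -sumrB; apply: eq_bigr => i _.
rewrite -scalerBl -RintegralB//; [|exact: integrable_coord|exact: integrable_coord].
by congr (_ *: _); apply: eq_Rintegral => y _; rewrite linearB.
Qed.

(** [f] and [g] are replaced by Borel representatives, for which the integral is additive and
    [norm_vintegral_le] holds. *)
Lemma vintegral_dist (f g : Y -> E) (k : Y -> R) (C : R) :
  L1 mu f -> L1 mu g -> (forall y, 0 <= k y) ->
  (\forall y \ae mu, `|f y - g y| <= k y) ->
  (\int[mu]_y (k y)%:E <= C%:E)%E ->
  `|vintegral mu f - vintegral mu g| <= C.
Proof.
move=> [[f' mf' ff'] foo] [[g' mg' gg'] goo] k0 fgk kC.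
have {}foo : (\int[mu]_y `|f' y|%:E < +oo)%E.
  apply: le_lt_trans foo; apply: ge0_le_integral_ae => [y|y|]; rewrite ?lee_fin//.
  by apply: filterS ff' => y ->.
have {}goo : (\int[mu]_y `|g' y|%:E < +oo)%E.
  apply: le_lt_trans goo; apply: ge0_le_integral_ae => [y|y|]; rewrite ?lee_fin//.
  by apply: filterS gg' => y ->.
have le_k : (\int[mu]_y `|f' y - g' y|%:E <= \int[mu]_y (k y)%:E)%E.
  apply: ge0_le_integral_ae => [y|y|]; rewrite ?lee_fin//.
  by apply: filterS3 ff' gg' fgk => y -> ->; rewrite lee_fin.
rewrite (vintegral_ae ff') (vintegral_ae gg') vintegralB// -lee_fin.
apply: (le_trans _ kC); apply: (le_trans _ le_k); apply: norm_vintegral_le.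
  exact: borel_funB.
by rewrite (le_lt_trans le_k)// (le_lt_trans kC)// ltry.
Qed.

Lemma L1_0 : L1 mu (fun=> 0 : E).
Proof.
split; first by exists (fun=> 0); [exact: borel_fun_cst|exact: filterE].
by under eq_integral do rewrite normr0; rewrite integral0.
Qed.

Lemma vintegral0 : vintegral mu (fun=> 0 : E) = 0.
Proof.
rewrite /vintegral big1// => i _.
rewrite linear0 /Rintegral integral0 ?scale0r//.
Qed.

Lemma vintegral_bound (f : Y -> E) (k : Y -> R) (C : R) :
  L1 mu f -> (forall y, 0 <= k y) -> (\forall y \ae mu, `|f y| <= k y) ->
  (\int[mu]_y (k y)%:E <= C%:E)%E -> `|vintegral mu f| <= C.
Proof.
move=> fL1 k0 fk kC.
have := vintegral_dist fL1 L1_0 k0 _ kC; rewrite vintegral0 subr0; apply.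
by apply: filterS fk => y; rewrite subr0.
Qed.

End vintegral.

(** * The integral pseudometric [osc] of the kernel *)

Section kernel.
Context d (Y : measurableType d) (R : realType) (mu : {measure set Y -> \bar R}).
Variables (X E : finBanachType R) (K : X -> Y -> blin E).
Hypothesis HK : kernel_conditions mu K.

Definition osc (x z : X) : \bar R := (\int[mu]_y `|K x y - K z y|%:E)%E.

Lemma measurable_kernel_norm x : measurable_fun setT (fun y => `|K x y|).
Proof. by apply: measurable_opnorm => u; exact: borel_fun_eval (Car1 HK x). Qed.

Lemma measurable_blinB (A B : Y -> blin E) : borel_fun A -> borel_fun B ->
  measurable_fun setT (fun y => `|A y - B y|).
Proof.
move=> mA mB; apply: measurable_opnorm => u.
by apply: borel_funB; exact: borel_fun_eval.
Qed.

Lemma integral_kernel_le x : (\int[mu]_y `|K x y|%:E <= kernel_bound mu K)%E.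
Proof. by apply: ereal_sup_ubound; exists x. Qed.

Lemma kernel_bound_ge0 : (0 <= kernel_bound mu K)%E.
Proof. by apply: le_trans (integral_kernel_le 0); apply: integral_ge0. Qed.

Definition kbound : R := fine (kernel_bound mu K).

Lemma kboundE : kbound%:E = kernel_bound mu K.
Proof. by rewrite fineK// ge0_fin_numE ?kernel_bound_ge0//; exact: Car4 HK. Qed.

Lemma kbound_ge0 : 0 <= kbound.
Proof. by rewrite -lee_fin kboundE kernel_bound_ge0. Qed.

(** A triangle inequality through an arbitrary integrable [A]: the limits in (K1) are not themselves
    values of [K]. *)
Lemma osc_le_add x z (A : Y -> blin E) : L1 mu A ->
  (osc x z <= \int[mu]_y `|K x y - A y|%:E + \int[mu]_y `|K z y - A y|%:E)%E.
Proof.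
move=> [[B mB AB] _].
have eqAB (w : X) : (\int[mu]_y `|K w y - A y|%:E = \int[mu]_y `|K w y - B y|%:E)%E.
  by apply: ae_eq_integralT; apply: filterS AB => y ->.
rewrite !eqAB -ge0_integralD//; last 2 first.
- by apply/measurable_EFinP; exact: measurable_blinB (Car1 HK _) mB.
- by apply/measurable_EFinP; exact: measurable_blinB (Car1 HK _) mB.
apply: ge0_le_integral_ae => [y|y|]; rewrite ?lee_fin ?addr_ge0//.
apply: filterE => y; rewrite -EFinD lee_fin.
by rewrite -(subrKA (B y)) (distrC (K z y)) ler_normD.
Qed.

Lemma osc_le x z : (osc x z <= (kbound + kbound)%:E)%E.
Proof.
rewrite EFinD !kboundE.
apply: (@le_trans _ _ (\int[mu]_y (`|K x y|%:E + `|K z y|%:E))%E); last first.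
  rewrite ge0_integralD//; [by rewrite leeD// integral_kernel_le| |];
    by apply/measurable_EFinP; exact: measurable_kernel_norm.
apply: ge0_le_integral_ae => [y|y|]; rewrite ?lee_fin ?addr_ge0//.
by apply: filterE => y; rewrite -EFinD lee_fin ler_normB.
Qed.

(** Dominated convergence along a sequence tending to [x] inside the neighbourhood of (Car3), with
    bound [2 * D]. The null set in (Car3) depends on the point, and a sequence involves only
    countably many of them. *)
Lemma osc_cont x (e : R) : 0 < e -> \forall z \near x, (osc z x <= e%:E)%E.
Proof.
move=> e0; apply: contrapT => H.
have [U [D [oU Ux iD hD]]] := Car3 HK x.
have seqz k : exists z, [/\ U z, `|x - z| < k.+1%:R^-1 & ~ (osc z x <= e%:E)%E].
  apply: contrapT => /forallNP h; apply: H.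
  have Uk : nbhs x (U `&` ball x k.+1%:R^-1).
    apply: filterI; first exact: open_nbhs_nbhs.
    by apply: nbhsx_ballx; rewrite invr_gt0 ltr0n.
  apply: filterS Uk => z [Uz]; rewrite -ball_normE/= => xz.
  by apply: contrapT => hz; apply: (h z).
have [z hz] := choice seqz.
have mD : measurable_fun setT D by apply/measurable_EFinP; exact: measurable_int iD.
have zx : z k @[k --> \oo] --> x.
  apply/(@cvgrPdist_lt _ _ _ (nbhs \oo) _ z x) => a a0.
  have := near_infty_natSinv_lt (PosNum a0); apply: filterS => k /= ka.
  by have [_ + _] := hz k; move=> /lt_trans; apply.
pose f k y := `|K (z k) y - K x y|%:E.
have mf k : measurable_fun setT (f k).
  by apply/measurable_EFinP; exact: measurable_blinB (Car1 HK _) (Car1 HK _).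
have mf0 : measurable_fun setT (fun _ : Y => 0%:E : \bar R) by exact: measurable_cst.
have cf : {ae mu, forall y, [set: Y] y -> f ^~ y @ \oo --> 0%:E}.
  apply: filterS (Car2 HK) => y cK _; apply: cvg_EFin; first exact: filterE.
  rewrite -(normr0 (blin E)) -(subrr (K x y)).
  apply: cvg_norm; apply: cvgB; last exact: cvg_cst.
  exact: (continuous_cvg _ (cK x) zx).
have i2D : mu.-integrable setT (fun y => 2%:E * (D y)%:E)%E.
  exact: integrableZl.
have bf : {ae mu, forall y k, [set: Y] y -> (`|f k y| <= 2%:E * (D y)%:E)%E}.
  have : \forall y \ae mu, forall k, `|K (z k) y| <= D y.
    by apply: ae_foralln => k; apply: hD; case: (hz k).
  move: (hD _ Ux); apply: filterS2 => y Dx Dz k _.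
  rewrite /f abse_EFin normr_id -EFinM lee_fin.
  by rewrite (le_trans (ler_normB _ _))// mulr_natl mulr2n lerD.
have [_ + _] := dominated_convergence measurableT mf mf0 cf i2D bf.
move=> /fine_cvgP[_] /(@cvgrPdist_lt _ _ _ (nbhs \oo) _ _ _) /(_ _ e0).
move=> [N _ /(_ N (leqnn N))].
have [_ _] := hz N; rewrite /osc => + h; apply.
move: h; rewrite /= sub0r normrN.
under eq_integral do rewrite subr0 normr_id.
set I := (\int[mu]_y _)%E => h.
have I0 : (0 <= I)%E by apply: integral_ge0.
have Ifin : I \is a fin_num.
  by rewrite ge0_fin_numE//; apply: le_lt_trans (osc_le (z N) x) (ltry _).
rewrite -(fineK Ifin) lee_fin ltW//.
by rewrite (le_lt_trans (ler_norm _)).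
Qed.
End kernel.

(** * The kernel and the nonlinearity *)

Section kernel_tail.
Context d (Y : measurableType d) (R : realType) (mu : {measure set Y -> \bar R}).
Variables (X E : finBanachType R) (K : X -> Y -> blin E).
Hypothesis HK : kernel_conditions mu K.

(** A point outside the ball of radius [T] is moved radially onto its boundary: on a ray, both
    points are [e / 2]-close to the same limit [L v]. *)
Lemma osc_compact_net (e : R) : 0 < e -> exists T : R, forall x : X,
  exists2 z : X, `|z| <= T & (osc mu K x z <= e%:E)%E.
Proof.
move=> e0; have e20 : 0 < e / 2 by rewrite divr_gt0.
have [T0 [L [hL [B hB]]]] := K1 HK e20.
(* The maximum with 1 keeps [T] positive; [B] can be any number when the unit sphere is empty. *)
pose T := Num.max B 1; exists T => x.
have T0' : 0 < T by rewrite lt_max ltr01 orbT.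
have [xT|Tx] := leP `|x| T.
  exists x => //; rewrite /osc; under eq_integral do rewrite subrr normr0.
  by rewrite integral0 lee_fin ltW.
have nx : 0 < `|x| by exact: lt_trans Tx.
pose v := `|x|^-1 *: x.
have v1 : `|v| = 1 by rewrite normrZ ger0_norm ?invr_ge0// mulVf// gt_eqF.
have xE : x = `|x| *: v by rewrite scalerA mulfV ?gt_eqF// scale1r.
have [_ Lv hv] := hL _ v1.
have BT : T0 v <= T by rewrite le_max hB//; exists v.
exists (T *: v); first by rewrite normrZ v1 mulr1 ger0_norm// ltW.
apply: le_trans (osc_le_add HK x (T *: v) Lv) _.
rewrite (splitr e) EFinD leeD//; last exact: hv.
by rewrite {1}xE; apply: hv; rewrite (le_trans BT)// ltW.
Qed.

End kernel_tail.

(** * Superposition with the nonlinearity *)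

Section nemytskii.
Context d (Y : measurableType d) (R : realType) (mu : {measure set Y -> \bar R}).
Variables (E : finBanachType R) (F : Y -> E -> E) (phi : R -> R).
Hypothesis HF : nonlinearity_conditions mu F phi.

(* Compactness of balls makes the modulus of (F2) uniform in the base point. *)
Lemma nonlinearity_unif (r e : R) : 0 < e -> exists2 delta : R, 0 < delta &
  \forall y \ae mu, forall z w : E, `|z| <= r -> `|w - z| <= delta ->
    `|F y w - F y z| <= e.
Proof.
move=> e0; have e20 : 0 < e / 2 by rewrite divr_gt0.
pose P (q : R * Y) (z : E) := forall w, `|w - z| <= q.1 -> `|F q.2 w - F q.2 z| <= e.
(* Compactness over the product of the right neighbourhoods of 0 with the a.e. filter extracts one
   radius and one null set valid on the whole ball. *)
have : \forall q \near filter_prod ((0 : R)^'+) (almost_everywhere mu),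
    [set u : E | `|u| <= r] `<=` P q.
  have /compact_near_coveringP := @findim_ball_compact R E r.
  move=> /(_ _ (filter_prod ((0 : R)^'+) (almost_everywhere mu)) P).
  apply => z _; have [del del0 hdel] := F2 HF z e20.
  have d20 : 0 < del / 2 by rewrite divr_gt0.
  exists (ball z (del / 2), ([set t | t < del / 2] `*`
      [set y | forall w, `|w - z| <= del -> `|F y w - F y z| <= e / 2])) => /=.
    split; first exact: nbhsx_ballx.
    exists ([set t | t < del / 2],
      [set y | forall w, `|w - z| <= del -> `|F y w - F y z| <= e / 2]) => //=.
    by split=> //; exact: nbhs_right_lt.
  move=> [u [t y]] /= [+ [tdel hy]] w wu; rewrite -ball_normE/= => zu.
  have h1 : `|F y w - F y z| <= e / 2.
    by apply: hy; rewrite (splitr del) (le_trans (ler_distD u _ _))// lerD//;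
      [exact: le_trans wu (ltW tdel)|rewrite distrC ltW].
  have h2 : `|F y u - F y z| <= e / 2.
    by apply: hy; rewrite distrC; lra.
  by rewrite (splitr e) (le_trans (ler_distD (F y z) _ _))// lerD// distrC.
move=> [[A B] /= [A0 B0] AB].
have [t [t0 At]] : exists t : R, 0 < t /\ A t.
  near ((0 : R)^'+) => t; exists t; split; first by [].
  by near: t.
exists t => //; apply: filterS B0 => y By z w zr wz.
exact: (AB (t, y) (conj At By)).
Unshelve. all: by end_near. Qed.

(** [nonlinearity_unif] gives a null set for each radius and tolerance; countably many of each
    suffice, which places [z] and [e] under a single a.e. statement. *)
Lemma nonlinearity_continuous :
  \forall y \ae mu, forall z (e : R), 0 < e -> exists2 delta : R, 0 < delta &
    forall w, `|w - z| <= delta -> `|F y w - F y z| <= e.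
Proof.
have inv0 k : 0 < k.+1%:R^-1 :> R by rewrite invr_gt0.
have /choice[del hdel] : forall q : nat * nat, exists delta : R, 0 < delta /\
    \forall y \ae mu, forall z w : E, `|z| <= q.1%:R -> `|w - z| <= delta ->
    `|F y w - F y z| <= q.2.+1%:R^-1.
  by move=> q; have [t t0 ht] := nonlinearity_unif q.1%:R (inv0 q.2); exists t.
have : \forall y \ae mu, forall i j (z w : E), `|z| <= i%:R -> `|w - z| <= del (i, j) ->
    `|F y w - F y z| <= j.+1%:R^-1.
  by apply: ae_foralln => i; apply: ae_foralln => j; have [] := hdel (i, j).
apply: filterS => y hy z e e0.
pose i := Num.truncn `|z|; pose j := Num.truncn e^-1.
exists (del (i.+1, j)); first by case: (hdel (i.+1, j)).
move=> w wz; apply: (le_trans (hy _ _ _ _ _ wz)).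
  by rewrite ltW// truncnS_gt.
rewrite -[leRHS]invrK lef_pV2 ?posrE ?invr_gt0//.
by rewrite ltW// truncnS_gt.
Qed.

(** [f] is approximated by functions with values in a dense sequence, constant on the disjoint sets
    [seqDU (A k) j]. On each of them (F1) applies, and continuity of [F y] outside [N] gives the
    limit. *)
Lemma nonlinearity_borel (f : Y -> E) : borel_fun f ->
  exists2 g : Y -> E, borel_fun g & \forall y \ae mu, F y (f y) = g y.
Proof.
move=> mf; have [N [mN N0 hN]] := nonlinearity_continuous.
have [p hp] := findim_dense_seq E.
pose A k j := [set y | `|p j - f y| < k.+1%:R^-1].
have mA k j : measurable (A k j).
  have mpf : measurable_fun setT (fun y => `|p j - f y|).
    by apply: borel_fun_norm; apply: borel_funB => //; exact: borel_fun_cst.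
  rewrite (_ : A k j = (fun y => `|p j - f y|) @^-1` `]-oo, k.+1%:R^-1[%classic).
    by rewrite -[X in measurable X]setTI; apply: mpf.
  by apply/seteqP; split=> y /=; rewrite in_itv.
have /choice[J hJ] : forall q : nat * Y, exists j, seqDU (A q.1) j q.2.
  move=> [k y] /=; have [j hj] := hp (f y) k.+1%:R^-1 ltac:(by rewrite invr_gt0).
  have : (\bigcup_j A k j) y by exists j.
  by rewrite seqDU_bigcup_eq => -[i _ hi]; exists i.
(* The value 0 on [N] makes the convergence hold at every [y]. *)
pose h k y := if y \in N then 0 else F y (p (J (k, y))).
have mh k : borel_fun (h k).
  move=> _ B mB; rewrite setTI.
  have -> : h k @^-1` B = (N `&` [set _ | B 0]) `|`
      (~` N `&` \bigcup_j (seqDU (A k) j `&` (F ^~ (p j)) @^-1` B)).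
    apply/seteqP; split=> y; rewrite /h /=.
      case: ifPn => [/set_mem yN By|/negP yN By]; first by left.
      right; split; first by move=> ?; apply: yN; exact/mem_set.
      by exists (J (k, y)) => //; split=> //; exact: (hJ (k, y)).
    move=> [[yN By]|[yN [j _ [yj By]]]]; first by rewrite mem_set.
    rewrite memNset//; have -> : J (k, y) = j; last by [].
    apply: (@trivIset_seqDU _ (A k)) => //; exists y; split=> //.
    exact: (hJ (k, y)).
  apply: measurableU.
    apply: measurableI => //; have [B0|B0] := pselect (B 0).
      by rewrite (_ : [set _ | _] = setT)//; apply/seteqP; split.
    by rewrite (_ : [set _ | _] = set0)//; apply/seteqP; split.
  apply: measurableI; first exact: measurableC.
  apply: bigcup_measurable => j _; apply: measurableI.
    by apply: seqDU_measurable => i; exact: mA.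
  by have := F1 HF (p j); move=> /(_ measurableT _ mB); rewrite setTI.
exists (fun y => if y \in N then 0 else F y (f y)); last first.
  exists N; split=> // y /=; apply: contra_notP => yN.
  by rewrite memNset.
apply: (borel_fun_cvg mh) => y; rewrite /h.
case: ifPn => [_|/negP yN]; first exact: cvg_cst.
have {}hN : forall z (e : R), 0 < e -> exists2 delta : R, 0 < delta &
    forall w, `|w - z| <= delta -> `|F y w - F y z| <= e.
  by apply: contrapT => hy; apply: yN; apply/mem_set; exact: hN.
apply/(@cvgrPdist_le _ _ _ (nbhs \oo)) => e e0.
have [del del0 hdel] := hN (f y) _ e0.
have := near_infty_natSinv_lt (PosNum del0); apply: filterS => k /= kd.
rewrite distrC; apply: hdel; rewrite ltW//.
apply: lt_trans kd; have := hJ (k, y); rewrite /seqDU /= => -[]; exact.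
Qed.

Lemma nonlinearity_bound (f : Y -> E) (r : R) : 0 <= r ->
  (\forall y \ae mu, `|f y| <= r) -> \forall y \ae mu, `|F y (f y)| <= phi r.
Proof.
move=> r0; move: (F3_bound HF); apply: filterS2 => y Fy fy.
apply: le_trans (Fy _) _; apply: (F3_nondecreasing HF); rewrite ?in_itv/= ?andbT//.
Qed.

End nemytskii.

(** * The Hammerstein operator *)

Lemma ultra_cvg_compact (I : Type) (T : topologicalType) (F : set_system I)
    (f : I -> T) (A : set T) :
  UltraFilter F -> compact A -> (\forall i \near F, A (f i)) ->
  exists2 a, A a & f @ F --> a.
Proof.
move=> FU cA FA; have [a [Aa ca]] := cA (f @ F) _ FA.
exists a => // U Ua; have [//|FnU] := in_ultra_setVsetC (f @^-1` U) FU.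
have [x [Ux nUx]] := ca (~` U) U FnU Ua.
by [].
Qed.

(** * A compactness criterion of Arzela-Ascoli type in [BC X E] *)

Section bounded_continuous_compact.
Variables (R : realType) (X : topologicalType) (E : finBanachType R).
Variable w : X -> X -> \bar R.
Hypothesis w_cont : forall x (e : R), 0 < e -> \forall z \near x, (w z x <= e%:E)%E.
Hypothesis w_net : forall e : R, 0 < e -> exists2 A : set X, compact A &
  forall x, exists2 z, A z & (w x z <= e%:E)%E.

(** The modulus is expressed through real upper bounds [e] because [w] takes extended real
    values. *)
Definition has_modulus (c M : R) (h : X -> E) := (forall x, `|h x| <= c) /\
  (forall x z (e : R), 0 < e -> (w x z <= e%:E)%E -> `|h x - h z| <= M * e).

Lemma has_modulus_bc (c M : R) h : 0 <= M -> has_modulus c M h -> h \in @bc_pred R X E.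
Proof.
move=> M0 [hc hM]; apply/asboolP; split; last by exists c => _ [x _ <-].
move=> x; apply/(@cvgrPdist_le _ _ _ (nbhs x)) => e e0.
have eM : 0 < e / (M + 1) by rewrite divr_gt0// ltr_wpDl.
apply: filterS (w_cont x eM) => z zx.
rewrite distrC (le_trans (hM _ _ _ eM zx))// mulrCA -[leRHS]mulr1.
by rewrite ler_wpM2l ?(ltW e0)// ler_pdivrMr ?ltr_wpDl// mul1r lerDl.
Qed.

(** The pointwise limit [g] along an ultrafilter inherits the bound and the modulus. The modulus
    makes the convergence uniform on the compact set [A], and [w_net] carries it from [A] to all of
    [X]. *)
Lemma has_modulus_compact (c M : R) : 0 <= M ->
  compact [set h : BC X E | has_modulus c M h].
Proof.
move=> M0; rewrite compact_ultra => F FU FS.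
have ex x : exists u : E, (fun h : BC X E => h x) @ F --> u.
  have Fx : \forall h \near F, [set u : E | `|u| <= c] ((h : BC X E) x).
    by apply: filterS FS => h [+ _]; exact.
  have [u _ hu] := ultra_cvg_compact FU (@findim_ball_compact R E c) Fx.
  by exists u.
have [g hg] := choice ex.
have cl x (e : R) : 0 < e -> \forall h \near F, `|g x - (h : BC X E) x| <= e.
  by move=> e0; move: e e0; apply/cvgrPdist_le; exact: hg.
have gS : has_modulus c M g.
  split=> [x|x z e e0 xz]; apply/ler_addgt0Pr => a a0.
    have [h [[hc _] hx]] := filter_ex (filterI FS (cl x a a0)).
    rewrite -[g x](subrK (h x)) addrC (le_trans (ler_normD _ _))// lerD//.
  have a20 : 0 < a / 2 by rewrite divr_gt0.
  have [h [[_ hM] [hx hz]]] := filter_ex (filterI FS (filterI (cl x _ a20) (cl z _ a20))).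
  rewrite (le_trans (ler_distD (h x) _ _))// addrC (splitr a) addrA lerD//.
  rewrite (le_trans (ler_distD (h z) _ _))// lerD//; first exact: hM.
  by rewrite distrC.
pose G := MkBC (has_modulus_bc M0 gS); exists G; split=> //.
(* The estimate on [A] is [2 * (M * a) + a], and moving from [x] to [z] costs [M * a] for each of
   [g] and [h]: the total is [e]. *)
apply/cvgrPdist_le => e e0; pose a := e / (4 * M + 1).
have M4 : 0 < 4 * M + 1 by rewrite ltr_wpDl// mulr_ge0.
have a0 : 0 < a by rewrite divr_gt0.
have [A cA hA] := w_net a0.
have unif : \forall h \near F,
    A `<=` [set x | `|g x - (h : BC X E) x| <= 2 * (M * a) + a].
  have /compact_near_coveringP/(_ _ F
    (fun h x => `|g x - (h : BC X E) x| <= 2 * (M * a) + a)) := cA.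
  apply => x _.
  exists ([set z | w z x <= a%:E]%E, [set h : BC X E | has_modulus c M h] `&`
      [set h : BC X E | `|g x - h x| <= a]) => /=.
    by split; [exact: w_cont|exact: filterI FS (cl x a a0)].
  move=> [z h] /= [zx [[_ hM] hx]].
  have g1 := gS.2 _ _ _ a0 zx; have h1 := hM _ _ _ a0 zx.
  rewrite (le_trans (ler_distD (g x) _ _))//.
  have := ler_distD (h x) (g x) (h z).
  by rewrite (distrC (h x) (h z)); lra.
apply: filterS (filterI FS unif) => h [[_ hM] hu].
apply: supnorm_le => [|x _]; first exact: ltW.
have [z Az xz] := hA x.
have g1 := gS.2 _ _ _ a0 xz; have h1 := hM _ _ _ a0 xz.
have := hu _ Az; rewrite /= => h2.
have h3 := ler_distD (g z) (g x) (h x); have h4 := ler_distD (h z) (g z) (h x).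
have aE : a * (4 * M + 1) = e by rewrite /a mulfVK// gt_eqF.
rewrite (distrC (h z) (h x)) in h4.
by change (`|g x - h x| <= e); lra.
Qed.

End bounded_continuous_compact.

Section hammerstein_operator.
Context d (Y : measurableType d) (R : realType) (mu : {measure set Y -> \bar R}).
Variables (X E : finBanachType R) (K : X -> Y -> blin E) (F : Y -> E -> E).
Variable phi : R -> R.
Hypotheses (HK : kernel_conditions mu K) (HF : nonlinearity_conditions mu F phi).

Local Notation ham := (hammerstein mu K F).
Local Notation kb := (kbound mu K).

Lemma integral_scale_le (k : Y -> R) (M C : R) : measurable_fun setT k ->
  (forall y, 0 <= k y) -> 0 <= M -> (\int[mu]_y (k y)%:E <= C%:E)%E ->
  (\int[mu]_y (M * k y)%:E <= (M * C)%:E)%E.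
Proof.
move=> mk k0 M0 kC; under eq_integral do rewrite EFinM.
rewrite ge0_integralZl// ?EFinM ?lee_wpmul2l// ?lee_fin//.
  exact/measurable_EFinP.
by move=> y _; rewrite lee_fin.
Qed.

Lemma kernel_app_norm (T : blin E) u (M : R) : `|u| <= M -> `|T u| <= M * `|T|.
Proof.
by move=> uM; rewrite (le_trans (le_opnorm _ _))// mulrC ler_wpM2r.
Qed.

Lemma hammerstein_L1 f r x : borel_fun f -> 0 <= r ->
  (\forall y \ae mu, `|f y| <= r) -> L1 mu (fun y => K x y (F y (f y))).
Proof.
move=> mf r0 fr; split.
  have [g mg Fg] := nonlinearity_borel HF mf.
  exists (fun y => K x y (g y)); last by apply: filterS Fg => y ->.
  by apply: borel_fun_app => // u; exact: borel_fun_eval (Car1 HK x).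
(* The absolute value is there because [phi r] can be negative when [mu] is the zero measure. *)
apply: (@le_lt_trans _ _ (`|phi r| * kb)%:E); last exact: ltry.
have := integral_kernel_le mu K x; rewrite -kboundE// => /integral_scale_le h.
apply: le_trans (h (`|phi r|) _ _ _) => //; last exact: measurable_kernel_norm HK x.
apply: ge0_le_integral_ae => [y|y|]; rewrite ?lee_fin ?mulr_ge0//.
apply: filterS (nonlinearity_bound HF r0 fr) => y Fy; rewrite lee_fin.
by apply: kernel_app_norm; rewrite (le_trans Fy)// ler_norm.
Qed.

(** [M] is left free for two uses: the absolute value of [phi r] on bounded sets, and [phi t] for
    the invariant ball, where [M * kb] is exactly [t]. *)
Lemma hammerstein_has_modulus f r M : borel_fun f -> 0 <= r ->
  (\forall y \ae mu, `|f y| <= r) -> 0 <= M -> phi r <= M ->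
  has_modulus (osc mu K) (M * kb) M (ham f).
Proof.
move=> mf r0 fr M0 pM.
have FM : \forall y \ae mu, `|F y (f y)| <= M.
  by apply: filterS (nonlinearity_bound HF r0 fr) => y /le_trans; apply.
have L1x x := hammerstein_L1 x mf r0 fr.
split=> [x|x z e e0 xz].
  apply: (@vintegral_bound _ _ _ _ _ _ (fun y => M * `|K x y|)) => //.
  - by move=> y; rewrite mulr_ge0.
  - by apply: filterS FM => y; exact: kernel_app_norm.
  - apply: integral_scale_le => //; first exact: measurable_kernel_norm HK x.
    by rewrite kboundE//; exact: integral_kernel_le.
apply: (@vintegral_dist _ _ _ _ _ _ _ (fun y => M * `|K x y - K z y|)) => //.
- by move=> y; rewrite mulr_ge0.
- by apply: filterS FM => y /(kernel_app_norm (K x y - K z y)).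
- apply: integral_scale_le => //.
  exact: measurable_blinB (Car1 HK x) (Car1 HK z).
Qed.

Lemma hammerstein_dist f g r e x : borel_fun f -> borel_fun g -> 0 <= r ->
  (\forall y \ae mu, `|f y| <= r) -> (\forall y \ae mu, `|g y| <= r) -> 0 <= e ->
  (\forall y \ae mu, `|F y (f y) - F y (g y)| <= e) ->
  `|ham f x - ham g x| <= e * kb.
Proof.
move=> mf mg r0 fr gr e0 fg.
have L1f := hammerstein_L1 x mf r0 fr; have L1g := hammerstein_L1 x mg r0 gr.
apply: (@vintegral_dist _ _ _ _ _ _ _ (fun y => e * `|K x y|)) => //.
- by move=> y; rewrite mulr_ge0.
- apply: filterS fg => y /(kernel_app_norm (K x y)).
  have -> // : K x y (F y (f y) - F y (g y)) = K x y (F y (f y)) - K x y (F y (g y)).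
  have := blin_linear (K x y) (-1) (F y (g y)) (F y (f y)).
  by rewrite !scaleN1r ![- _ + _]addrC.
- apply: integral_scale_le => //; first exact: measurable_kernel_norm HK x.
  by rewrite kboundE//; exact: integral_kernel_le.
Qed.

Lemma hammerstein_unif r (e : R) : 0 <= r -> 0 < e -> exists2 delta : R, 0 < delta &
  forall f g x, borel_fun f -> borel_fun g ->
  (\forall y \ae mu, `|f y| <= r) -> (\forall y \ae mu, `|g y| <= r) ->
  (\forall y \ae mu, `|f y - g y| <= delta) -> `|ham f x - ham g x| <= e.
Proof.
move=> r0 e0; have kb0 := kbound_ge0 HK.
have e'0 : 0 < e / (kb + 1) by rewrite divr_gt0// ltr_wpDl.
have [del del0 hdel] := nonlinearity_unif HF r e'0; exists del => // f g x mf mg fr gr fg.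
apply: (@le_trans _ _ (e / (kb + 1) * kb)); last first.
  by rewrite mulrAC ler_pdivrMr ?ltr_wpDl// ler_wpM2l ?lerDl// ltW.
apply: (hammerstein_dist x mf mg r0) => //; first exact: ltW.
by apply: filterS3 hdel gr fg => y hy; exact: hy.
Qed.

Lemma osc_net_compact (e : R) : 0 < e -> exists2 A : set X, compact A &
  forall x, exists2 z, A z & (osc mu K x z <= e%:E)%E.
Proof.
move=> /(osc_compact_net HK)[T hT]; exists [set x : X | `|x| <= T] => //.
exact: findim_ball_compact.
Qed.

Lemma hammerstein_compact c M : 0 <= M ->
  compact [set h : BC X E | has_modulus (osc mu K) c M h].
Proof.
exact: has_modulus_compact (osc_cont HK) osc_net_compact c M.
Qed.

Lemma hammerstein_bc f r : borel_fun f -> 0 <= r ->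
  (\forall y \ae mu, `|f y| <= r) -> ham f \in @bc_pred R X E.
Proof.
move=> mf r0 fr; apply: (has_modulus_bc (osc_cont HK) (normr_ge0 (phi r))).
exact: hammerstein_has_modulus mf r0 fr _ (ler_norm _).
Qed.

(** The default 0 makes this total; [hammersteinBCE] shows that it is not reached for essentially
    bounded Borel [f]. *)
Definition hammersteinBC (f : Y -> E) : BC X E := insubd 0 (ham f).

Lemma hammersteinBCE f r : borel_fun f -> 0 <= r ->
  (\forall y \ae mu, `|f y| <= r) -> hammersteinBC f = ham f :> (X -> E).
Proof. by move=> mf r0 fr; apply: insubdK; exact: hammerstein_bc mf r0 fr. Qed.

Lemma hammersteinBC_unif r (e : R) : 0 <= r -> 0 < e -> exists2 delta : R, 0 < delta &
  forall f g, borel_fun f -> borel_fun g ->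
  (\forall y \ae mu, `|f y| <= r) -> (\forall y \ae mu, `|g y| <= r) ->
  (\forall y \ae mu, `|f y - g y| <= delta) -> `|hammersteinBC f - hammersteinBC g| <= e.
Proof.
move=> r0 e0; have [del del0 hdel] := hammerstein_unif r0 e0.
exists del => // f g mf mg fr gr fg; apply: supnorm_le => [|x _]; first exact: ltW.
change (`|hammersteinBC f x - hammersteinBC g x| <= e).
by rewrite (hammersteinBCE mf r0 fr) (hammersteinBCE mg r0 gr); exact: hdel.
Qed.

Lemma hammerstein_ae f g : (\forall y \ae mu, f y = g y) -> ham f = ham g.
Proof.
move=> fg; apply/funext => x; apply: vintegral_ae.
by apply: filterS fg => y ->.
Qed.

End hammerstein_operator.

Section Linfty.
Context d (Y : measurableType d) (R : realType) (mu : {measure set Y -> \bar R}).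
Variable E : finBanachType R.

Lemma Linfty_le_norm (u : Linfty mu E) : \forall y \ae mu, `|repr u y| <= `|u|.
Proof. by apply: le_ess_norm; exact: linf_ess_norm. Qed.

Lemma Linfty_reprB (u v : Linfty mu E) :
  \forall y \ae mu, repr (u - v) y = repr u y - repr v y.
Proof.
have h1 : \forall y \ae mu, repr (u - v) y = (repr u + repr (- v)) y.
  by apply/Linfty_classP; rewrite Linfty_repr.
have h2 : \forall y \ae mu, repr (- v) y = (- repr v) y.
  by apply/Linfty_classP; rewrite Linfty_repr.
by apply: filterS2 h1 h2 => y -> /= hv; rewrite !fctE hv.
Qed.

End Linfty.

Theorem theorem6 (R : realType) (X E : finBanachType R) :
  (forall (d : measure_display) (Y : measurableType d)
      (mu : {measure set Y -> \bar R})
      (K : X -> Y -> blin E) (F : Y -> E -> E) (phi : R -> R),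
    kernel_conditions mu K -> nonlinearity_conditions mu F phi ->
    exists H : Linfty mu E -> BC X E,
      (forall (f : linf_fun mu E) (x : X),
        L1 mu (fun y => K x y (F y (f y))) /\
        H (Linfty_class f) x = hammerstein mu K F f x) /\
      compact_operator H)
  /\
  (forall (Sigma : set (set X)), sigma_algebra [set: X] Sigma ->
    @open X `<=` Sigma ->
    forall (mu : {measure set (g_sigma_algebraType Sigma) -> \bar R})
      (K : X -> X -> blin E) (F : X -> E -> E) (phi : R -> R),
    kernel_conditions mu K -> nonlinearity_conditions mu F phi ->
    (exists t : R, 0 < t /\ (kernel_bound mu K * (phi t)%:E = t%:E)%E) ->
    exists H : BC X E -> BC X E,
      (forall (f : BC X E) (x : X),
        L1 mu (fun y => K x y (F y (f y))) /\
        H f x = hammerstein mu K F f x) /\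
      exists f : BC X E, H f = f).
Proof.
split=> [d Y mu K F phi HK HF|Sigma sS oS mu K F phi HK HF [t [t0 tE]]].
  exists (fun u : Linfty mu E => hammersteinBC mu K F (repr u)); split.
    move=> f x; have fr := le_ess_norm (linf_ess_norm f).
    have r0 : 0 <= fine (ess_norm mu f) by rewrite fine_ge0// ess_norm_ge0.
    split; first exact: (hammerstein_L1 HK HF x (linf_borel f) r0 fr).
    rewrite (hammersteinBCE HK HF (linf_borel _) (normr_ge0 _) (Linfty_le_norm _)); congr (_ x); apply: hammerstein_ae.
    by apply/Linfty_classP; rewrite Linfty_repr.
  split=> [u|B [M0 [_ hM0]]].
    apply/(@cvgrPdist_le _ _ _ (nbhs u) (nbhs_filter u)) => e e0.
    (* Every [v] at distance less than 1 from [u] lies, like [u], in the ball of this radius, on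
       which the operator is uniformly continuous. *)
    have r0 : 0 <= `|u| + 1 by rewrite addr_ge0.
    have [del del0 hdel] := hammersteinBC_unif HK HF r0 e0.
    have m0 : 0 < Num.min del 1 by rewrite lt_min del0 ltr01.
    apply/nbhs_ballP; exists (Num.min del 1) => // v uv.
    have {}uv : `|u - v| < Num.min del 1 by exact: uv.
    have [udel u1] : `|u - v| < del /\ `|u - v| < 1 by move: uv; rewrite lt_min => /andP.
    apply: hdel; try exact: linf_borel.
    - by apply: filterS (Linfty_le_norm u) => y /le_trans; apply; rewrite lerDl.
    - apply: filterS (Linfty_le_norm v) => y /le_trans; apply.
      rewrite -[v](subKr u) (le_trans (ler_normB _ _))// lerD2l ltW//.
    - apply: filterS2 (Linfty_reprB u v) (Linfty_le_norm (u - v)) => y ->.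
      by move=> /le_trans; apply; exact: ltW.
  (* Boundedness of [B] gives a bound by every number strictly above [M0]; this one is also
     nonnegative. *)
  pose r := `|M0| + 1.
  have r0 : 0 <= r by rewrite addr_ge0.
  have Br u : B u -> `|u| <= r.
    by apply: hM0; rewrite /r (le_lt_trans (ler_norm M0))// ltrDl.
  apply: (@precompact_subset _ _ [set h : BC X E |
    has_modulus (osc mu K) (`|phi r| * kbound mu K) `|phi r| h]).
    move=> _ [u Bu <-].
    have ur : \forall y \ae mu, `|repr u y| <= r.
      by apply: filterS (Linfty_le_norm u) => y /le_trans; apply; exact: Br.
    rewrite /= (hammersteinBCE HK HF (linf_borel _) r0 ur).
    exact: (hammerstein_has_modulus HK HF (linf_borel _) r0 ur _ (ler_norm _)).
  apply: compact_precompact; first exact: norm_hausdorff.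
  exact: hammerstein_compact.
have mBC (f : BC X E) : borel_fun (f : g_sigma_algebraType Sigma -> E).
  apply: (@measurability _ _ (g_sigma_algebraType Sigma)
    (g_sigma_algebraType (@open E)) _ _ (@open E)) => //.
  move=> _ [U oU <-]; rewrite setTI; apply: sub_sigma_algebra; apply: oS.
  by have /continuousP cf := @BC_continuous _ _ _ f; exact: cf.
have leBC (f : BC X E) (r : R) : `|f| <= r -> \forall y \ae mu, `|f y| <= r.
  by move=> fr; apply: aeW => y; apply: le_trans fr; apply: le_supnorm (BC_bounded f) _.
exists (fun f => hammersteinBC mu K F f); split.
  move=> f x; have fr := leBC f _ (lexx _).
  split; first exact: (hammerstein_L1 HK HF x (mBC f) (normr_ge0 f) fr).
  by rewrite (hammersteinBCE HK HF (mBC f) (normr_ge0 f) fr).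
have kphi : kbound mu K * phi t = t.
  by apply: EFin_inj; rewrite EFinM kboundE.
have phi0 : 0 <= phi t.
  by have := kbound_ge0 HK; nra.
(* By [kphi], the bound [phi t * kbound mu K] on the values is [t], so the images of the ball lie in
   a compact subset of that same ball. *)
apply: (@schauder_ball _ _ _ t [set h : BC X E | has_modulus (osc mu K) t (phi t) h]).
- exact: ltW.
- exact: hammerstein_compact.
- by move=> h [ht _]; apply: supnorm_le => // ; exact: ltW.
- move=> f ft; rewrite /= (hammersteinBCE HK HF (mBC f) (ltW t0) (leBC f _ ft)).
  rewrite -{1}kphi mulrC.
  exact: (hammerstein_has_modulus HK HF (mBC f) (ltW t0) (leBC f _ ft) phi0 (lexx _)).
- move=> e e0; have [del del0 hdel] := hammersteinBC_unif HK HF (ltW t0) e0.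
  exists del => // f g ft gt fg; apply: hdel; try exact: mBC; try exact: leBC.
  exact: (leBC (f - g)).
Qed.
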